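(* Let $\Theta$ and $\Phi$ be CP maps on a von Neumann algebra $\mathcal{M}\subseteq B(H)$, and let $(E,\xi)$ and $(F,\eta)$ be the GNS representations of $\Theta$ and $\Phi$, respectively. Then $\Theta$ and $\Phi$ commute strongly if and only if there exists a unitary bimodule map $$w:E\otimes F\to F\otimes E$$ sending $\xi\otimes\eta$ to $\eta\otimes\xi$.
   Context: A *CP map* on $\mathcal{M}$ is a contractive, normal, completely positive linear map $\mathcal{M}\to\mathcal{M}$. Inner products are linear in the second variable. **Strong commutativity.** The Hilbert space $\mathcal{M}\otimes_\Phi\mathcal{M}\otimes_\Theta H$ is the Hausdorff completion of the algebraic tensor product $\mathcal{M}\otimes\mathcal{M}\otimes H$ with respect to $$\langle a\otimes b\otimes h,\,c\otimes d\otimes k\rangle=\langle h,\Theta(b^*\Phi(a^*c)d)k\rangle,$$ and $\mathcal{M}\otimes_\Theta\mathcal{M}\otimes_\Phi H$ is defined by exchanging the roles of $\Theta$ and $\Phi$. $\Theta$ and $\Phi$ *commute strongly* if there is a unitary $u:\mathcal{M}\otimes_\Phi\mathcal{M}\otimes_\Theta H\to\mathcal{M}\otimes_\Theta\mathcal{M}\otimes_\Phi H$ such that (i) $u(a\otimes_\Phi I\otimes_\Theta h)=a\otimes_\Theta I\otimes_\Phi h$ for all $a\in\mathcal{M}$, $h\in H$; (ii) $u(ca\otimes_\Phi b\otimes_\Theta h)=(c\otimes I\otimes I)u(a\otimes_\Phi b\otimes_\Theta h)$ for all $a,b,c\in\mathcal{M}$, $h\in H$; (iii) $u(a\otimes_\Phi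 b\otimes_\Theta dh)=(I\otimes I\otimes d)u(a\otimes_\Phi b\otimes_\Theta h)$ for all $a,b\in\mathcal{M}$, $d\in\mathcal{M}'$, $h\in H$. **GNS representation.** $E=\mathcal{M}\otimes_\Theta\mathcal{M}$ is the W$^*$-correspondence over $\mathcal{M}$ obtained from the algebraic tensor product $\mathcal{M}\otimes\mathcal{M}$ (by Hausdorff completion and self-dual extension) with the $\mathcal{M}$-valued inner product $\langle a\otimes b,a'\otimes b'\rangle=b^*\Theta(a^*a')b'$ and the obvious left and right actions of $\mathcal{M}$, and $\xi=1\otimes1$ (so $\langle\xi,a\xi\rangle=\Theta(a)$ for $a\in\mathcal{M}$). $(F,\eta)$ is defined in the same way from $\Phi$. $E\otimes F$ is the balanced tensor product of W$^*$-correspondences over $\mathcal{M}$: the self-dual extension of the Hausdorff completion of the algebraic tensor product in the inner product $\langle x\otimes y,w\otimes z\rangle=\langle y,\langle x,w\rangle\cdot z\rangle$, with left action on $E$ and right action on $F$. *)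

(* Defs.v *)
From HB Require Import structures.
From mathcomp Require Import all_boot all_order all_algebra.
From mathcomp Require Import complex.
From mathcomp Require Import all_classical all_reals all_analysis.

Set Implicit Arguments.
Unset Strict Implicit.
Unset Printing Implicit Defensive.

Import Order.TTheory GRing.Theory Num.Theory numFieldNormedType.Exports.

Local Open Scope classical_set_scope.
Local Open Scope ring_scope.

(* Complex Hilbert spaces. Inner products are linear in the second variable;
   positivity and definiteness of [ip] follow from [ip_norm]. *)
HB.mixin Record NormedModule_isHilbert (R : realType) H
    of CompleteNormedModule R[i] H := {
  ip : H -> H -> R[i];
  ip_linear : forall (x : H) (c : R[i]) (y z : H),
    ip x (c *: y + z) = c * ip x y + ip x z;
  ip_conj : forall x y : H, ip y x = conjc (ip x y);
  ip_norm : forall x : H, `|x| ^+ 2 = ip x x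
}.

#[short(type="hilbertType")]
HB.structure Definition Hilbert (R : realType) :=
  {H of NormedModule_isHilbert R H & CompleteNormedModule R[i] H}.

(* The norm of a normed R[i]-module takes its values in R[i]. *)
Definition rnorm (R : realType) (V : normedModType R[i]) (x : V) : R :=
  complex.Re `|x|.

(* Operators on H are functions H -> H: they are added and scaled pointwise,
   and [\o] is the product of B(H). *)
Section Operators.
Context {R : realType}.

Definition bounded_linear (V W : normedModType R[i]) (T : V -> W) : Prop :=
  linear T /\ exists r : R, forall x, rnorm (T x) <= r * rnorm x.

Definition is_adjoint (H : hilbertType R) (T S : H -> H) : Prop :=
  forall x y : H, ip (T x) y = ip x (S y).

Definition adj (H : hilbertType R) (T : H -> H) : H -> H :=
  xget (fun=> 0) [set S | is_adjoint T S].

Definition positive_op (H : hilbertType R) (T : H -> H) : Prop :=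
  forall x : H, 0 <= ip x (T x).

Definition opnorm (H : hilbertType R) (T : H -> H) : R :=
  inf [set r : R | 0 <= r /\ forall x : H, rnorm (T x) <= r * rnorm x].

Definition unitary (V W : hilbertType R) (u : V -> W) : Prop :=
  [/\ linear u,
      forall x y, ip (u x) (u y) = ip x y &
      forall y, exists x, u x = y].

Definition commutant (H : hilbertType R) (A : set (H -> H)) : set (H -> H) :=
  [set T | bounded_linear T /\ forall S, A S -> T \o S = S \o T].

Definition linear_on (V W : lmodType R[i]) (A : set V) (f : V -> W) : Prop :=
  forall (c : R[i]) x y, A x -> A y -> f (c *: x + y) = c *: f x + f y.

End Operators.

Record vonNeumannAlgebra (R : realType) (H : hilbertType R) := VNAlgebra {
  vn_set :> (H -> H) -> Prop;
  vn_adj : forall T, vn_set T -> exists2 S, vn_set S & is_adjoint T S;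
  vn_bicommutant : commutant (commutant vn_set) = vn_set
}.

(* The sigma-weak (ultraweak) topology is the initial topology of the
   functionals T |-> \sum_n <x_n, T y_n> with x, y square summable. *)
Section SigmaWeak.
Context {R : realType} (H : hilbertType R).

Definition square_summable (x : nat -> H) : Prop :=
  cvgn (series (fun n => rnorm (x n) ^+ 2)).

Definition sigma_weak_functional (x y : nat -> H) (T : H -> H) : R[i]^o :=
  limn (series (fun n => ip (x n) (T (y n)) : R[i]^o)).

Definition sigma_weak_cvg (F : set_system (H -> H)) (T : H -> H) : Prop :=
  forall x y : nat -> H, square_summable x -> square_summable y ->
    sigma_weak_functional x y S @[S --> F] --> sigma_weak_functional x y T.

(* sigma-weak continuity on A, in terms of filters on A *)
Definition normal_on (A : set (H -> H)) (f : (H -> H) -> (H -> H)) : Prop :=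
  forall (F : set_system (H -> H)) (T : H -> H), ProperFilter F ->
    F A -> A T -> sigma_weak_cvg F T -> sigma_weak_cvg (f @ F) (f T).

Definition completely_positive_on (A : set (H -> H))
    (f : (H -> H) -> (H -> H)) : Prop :=
  forall (n : nat) (T : 'I_n -> 'I_n -> H -> H),
    (forall i j, A (T i j)) ->
    (forall x : 'I_n -> H, 0 <= \sum_i \sum_j ip (x i) (T i j (x j))) ->
    forall x : 'I_n -> H, 0 <= \sum_i \sum_j ip (x i) (f (T i j) (x j)).

End SigmaWeak.

(* The values of Theta outside M are irrelevant. *)
Record cp_map (R : realType) (H : hilbertType R) (M : vonNeumannAlgebra H)
    (Theta : (H -> H) -> (H -> H)) : Prop := CPMap {
  cp_stable : forall a, M a -> M (Theta a);
  cp_linear : linear_on M Theta;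
  cp_contractive : forall a, M a -> opnorm (Theta a) <= opnorm a;
  cp_normal : normal_on M Theta;
  cp_positive : completely_positive_on M Theta
}.

(* The Hausdorff completion M (x)_Psi1 M (x)_Psi2 H up to isomorphism: a Hilbert
   space with a trilinear map [t3] (i.e. a linear map on the algebraic tensor
   product) which carries the semi-inner product to the inner product and whose
   elementary tensors span a dense subspace. *)
Record tensor3 (R : realType) (H : hilbertType R) (M : vonNeumannAlgebra H)
    (Psi1 Psi2 : (H -> H) -> (H -> H)) := Tensor3 {
  t3_space :> hilbertType R;
  t3 : (H -> H) -> (H -> H) -> H -> t3_space;
  t3_linear1 : forall b h, M b -> linear_on M (fun a => t3 a b h);
  t3_linear2 : forall a h, M a -> linear_on M (fun b => t3 a b h);
  t3_linear3 : forall a b, M a -> M b -> linear (t3 a b);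
  t3_ip : forall a b h c d k, M a -> M b -> M c -> M d ->
    ip (t3 a b h) (t3 c d k)
    = ip h (Psi2 (adj b \o Psi1 (adj a \o c) \o d) k);
  t3_dense : dense [set x : t3_space | exists (n : nat)
    (a b : 'I_n -> H -> H) (h : 'I_n -> H),
    (forall i, M (a i) /\ M (b i)) /\ x = \sum_i t3 (a i) (b i) (h i)]
}.

Section StrongCommutation.
Context {R : realType} (H : hilbertType R) (M : vonNeumannAlgebra H).

(* L = c (x) I (x) I *)
Definition is_left_ampliation (Psi1 Psi2 : (H -> H) -> (H -> H))
    (K : tensor3 M Psi1 Psi2) (c : H -> H) (L : K -> K) : Prop :=
  bounded_linear L /\
  forall a b h, M a -> M b -> L (t3 K a b h) = t3 K (c \o a) b h.

(* L = I (x) I (x) d *)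
Definition is_right_ampliation (Psi1 Psi2 : (H -> H) -> (H -> H))
    (K : tensor3 M Psi1 Psi2) (d : H -> H) (L : K -> K) : Prop :=
  bounded_linear L /\
  forall a b h, M a -> M b -> L (t3 K a b h) = t3 K a b (d h).

(* K1 = M (x)_Phi M (x)_Theta H and K2 = M (x)_Theta M (x)_Phi H *)
Definition commute_strongly (Theta Phi : (H -> H) -> (H -> H))
    (K1 : tensor3 M Phi Theta) (K2 : tensor3 M Theta Phi) : Prop :=
  exists u : K1 -> K2,
  [/\ unitary u,
      forall a h, M a -> u (t3 K1 a id h) = t3 K2 a id h,
      forall c, M c -> exists2 L : K2 -> K2, is_left_ampliation c L &
        forall a b h, M a -> M b -> u (t3 K1 (c \o a) b h) = L (u (t3 K1 a b h)) &
      forall d, commutant M d -> exists2 L : K2 -> K2, is_right_ampliation d L &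
        forall a b h, M a -> M b -> u (t3 K1 a b (d h)) = L (u (t3 K1 a b h))].

End StrongCommutation.

(* Right modules over M with an M-valued inner product. *)
Record preHilbertModule (R : realType) (H : hilbertType R)
    (M : vonNeumannAlgebra H) := PreHilbertModule {
  hm_space :> lmodType R[i];
  ract : hm_space -> (H -> H) -> hm_space;
  ract_linearl : forall a, M a -> linear (fun x => ract x a);
  ract_linearr : forall x, linear_on M (ract x);
  ractM : forall x a b, M a -> M b -> ract x (a \o b) = ract (ract x a) b;
  ract1 : forall x, ract x id = x;
  mip : hm_space -> hm_space -> (H -> H);
  mip_in : forall x y, M (mip x y);
  mip_linear : forall x, linear (mip x);
  mip_ract : forall x y a, M a -> mip x (ract y a) = mip x y \o a;
  mip_adj : forall x y, is_adjoint (mip x y) (mip y x);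
  mip_ge0 : forall x, positive_op (mip x x);
  mip_eq0 : forall x, mip x x = 0 -> x = 0
}.

Section HilbertModules.
Context {R : realType} (H : hilbertType R) (M : vonNeumannAlgebra H).
Implicit Type E : preHilbertModule M.

Definition hmnorm E (x : E) : R := Num.sqrt (opnorm (mip x x)).

Definition hm_complete E : Prop :=
  forall s : nat -> E,
    (forall e : R, 0 < e -> exists N : nat, forall m n : nat,
        (N <= m)%N -> (N <= n)%N -> hmnorm (s m - s n) < e) ->
    exists x : E, forall e : R, 0 < e -> exists N : nat, forall n : nat,
        (N <= n)%N -> hmnorm (s n - x) < e.

Definition norm_closure E (S : set E) : set E :=
  [set x | forall e : R, 0 < e -> exists2 y, S y & hmnorm (x - y) < e].

(* bounded right M-linear maps S -> M, for S a submodule of E *)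
Definition bounded_module_map E (S : set E) (phi : E -> H -> H) : Prop :=
  [/\ forall x, S x -> M (phi x),
      linear_on S phi,
      forall x a, S x -> M a -> phi (ract x a) = phi x \o a &
      exists r : R, forall x, S x -> opnorm (phi x) <= r * hmnorm x].

Definition self_dual E : Prop :=
  forall phi, bounded_module_map [set: E] phi ->
    exists z : E, forall x, phi x = mip z x.

(* E is the self-dual extension of its submodule S: z |-> <z, .> identifies E
   with the module of all bounded M-linear maps S -> M (Paschke). *)
Definition is_self_dual_extension E (S : set E) : Prop :=
  self_dual E /\
  forall phi, bounded_module_map S phi ->
    exists! z : E, forall x, S x -> phi x = mip z x.

End HilbertModules.

(* W*-correspondences over M: self-dual Hilbert modules with a unital normal
   *-representation of M by adjointable operators. *)
Record wCorrespondence (R : realType) (H : hilbertType R)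
    (M : vonNeumannAlgebra H) := WCorrespondence {
  wc_module :> preHilbertModule M;
  wc_complete : hm_complete wc_module;
  wc_self_dual : self_dual wc_module;
  lact : (H -> H) -> wc_module -> wc_module;
  lact_linearl : forall x, linear_on M (fun a => lact a x);
  lact_linearr : forall a, M a -> linear (lact a);
  lactM : forall x a b, M a -> M b -> lact (a \o b) x = lact a (lact b x);
  lact1 : forall x, lact id x = x;
  lact_ract : forall x a b, M a -> M b ->
    lact a (ract x b) = ract (lact a x) b;
  lact_adj : forall x y a, M a -> mip (lact a x) y = mip x (lact (adj a) y);
  lact_normal : forall x y, normal_on M (fun a => mip x (lact a y))
}.

(* The GNS correspondence of Theta: the self-dual extension of the Hausdorff
   completion of the algebraic tensor product of M with itself. The latter is
   given by a bilinear map [gns_t]; its Hausdorff completion is the closure in E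
   of the span of the elementary tensors. *)
Record GNS (R : realType) (H : hilbertType R) (M : vonNeumannAlgebra H)
    (Theta : (H -> H) -> (H -> H)) := MkGNS {
  gns_corr :> wCorrespondence M;
  gns_t : (H -> H) -> (H -> H) -> gns_corr;
  gns_linear1 : forall b, M b -> linear_on M (fun a => gns_t a b);
  gns_linear2 : forall a, M a -> linear_on M (gns_t a);
  gns_mip : forall a b a' b', M a -> M b -> M a' -> M b' ->
    mip (gns_t a b) (gns_t a' b') = adj b \o Theta (adj a \o a') \o b';
  gns_lact : forall c a b, M c -> M a -> M b ->
    lact c (gns_t a b) = gns_t (c \o a) b;
  gns_ract : forall a b c, M a -> M b -> M c ->
    ract (gns_t a b) c = gns_t a (b \o c);
  gns_extension : is_self_dual_extension (norm_closure
    [set x : gns_corr | exists (n : nat) (a b : 'I_n -> H -> H),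
      (forall i, M (a i) /\ M (b i)) /\ x = \sum_i gns_t (a i) (b i)])
}.

Definition gns_vector (R : realType) (H : hilbertType R)
    (M : vonNeumannAlgebra H) (Theta : (H -> H) -> (H -> H))
    (E : GNS M Theta) : E := gns_t E id id.

Record balancedTensor (R : realType) (H : hilbertType R)
    (M : vonNeumannAlgebra H) (E F : wCorrespondence M) := BalancedTensor {
  bt_corr :> wCorrespondence M;
  bt : E -> F -> bt_corr;
  bt_linear1 : forall y, linear (fun x => bt x y);
  bt_linear2 : forall x, linear (bt x);
  bt_mip : forall x y w z,
    mip (bt x y) (bt w z) = mip y (lact (mip x w) z);
  bt_lact : forall a x y, M a -> lact a (bt x y) = bt (lact a x) y;
  bt_ract : forall x y a, M a -> ract (bt x y) a = bt x (ract y a);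
  bt_extension : is_self_dual_extension (norm_closure
    [set g : bt_corr | exists (n : nat) (x : 'I_n -> E) (y : 'I_n -> F),
      g = \sum_i bt (x i) (y i)])
}.

Definition unitary_bimodule_map (R : realType) (H : hilbertType R)
    (M : vonNeumannAlgebra H) (E F : wCorrespondence M) (w : E -> F) : Prop :=
  [/\ linear w,
      forall x a, M a -> w (ract x a) = ract (w x) a,
      forall a x, M a -> w (lact a x) = lact a (w x),
      forall x y, mip (w x) (w y) = mip x y &
      forall y, exists x, w x = y].

(* Main.v *)
(* To a self-dual module X over M corresponds the Hilbert space X (x)_M H, on which
   the elements of X are the operators x : H -> X (x)_M H intertwining the actions of
   M'; since M'' = M, a vector z and an operator commuting with M' determine the
   bounded module map y |-> z^* A y into M, which self-duality turns back into an
   element of X.  For X = F (x) E the space X (x)_M H is M (x)_Phi M (x)_Theta H, and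
   for X = E (x) F it is M (x)_Theta M (x)_Phi H.  Hence unitary bimodule maps
   w : E (x) F -> F (x) E correspond to unitaries u = (w (x) 1)^*, condition (ii)
   being left linearity, (iii) right linearity, and (i) w (xi (x) eta) = eta (x) xi.
   The delicate point is that (a (x) b) (x) xi, for a, b in M, already determine the
   self-dual extension: F is only the self-dual extension of its elementary tensors,
   which are sigma-strongly dense, so normality of the left action on E is needed. *)
Require Import Defs.
From HB Require Import structures.
From mathcomp Require Import all_boot all_order all_algebra.
From mathcomp Require Import complex ring lra.
From mathcomp Require Import all_classical all_reals all_analysis.

Set Implicit Arguments.
Unset Strict Implicit.
Unset Printing Implicit Defensive.

Import Order.TTheory GRing.Theory Num.Theory numFieldNormedType.Exports.
Import Normc.
Local Notation Re := complex.Re.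
Local Notation Im := complex.Im.

Local Open Scope classical_set_scope.
Local Open Scope complex_scope.
Local Open Scope ring_scope.

Arguments harmonic : simpl never.

(** * Complex numbers and inner products *)

(** No functional calculus is used. Boundedness of left multiplication by c on X (x)_M H is usually
    obtained by writing ||c||^2 - c^* c as a square. Here an operator is known only by its action on
    a total family together with a formal adjoint Q, and it is bounded as soon as the coefficients
    of the powers of Q^* Q grow at most exponentially. For M' this growth is visible on H. For M it
    comes from contractivity of Theta and Phi, hence is visible only on elementary tensors, whose
    totality must be proved before left multiplication becomes an operator. For a tensor product of
    correspondences, totality in turn uses left multiplication on the right-hand factor, which is a
    GNS module. Vectors and operators are obtained from the Riesz theorem, through their
    coefficients against a total family, instead of by continuous extension. The space X (x)_M H
    itself requires positivity of the matrices of entries <x_i, x_j>, although only <x, x> >= 0 is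
    given; a splitting of H along cyclic subspaces of M provides it. *)

Section ComplexNumbers.
Context {R : realType}.
Implicit Types z w : R[i].

Lemma ReD z w : Re (z + w) = Re z + Re w. Proof. by case: z w => [? ?] []. Qed.
Lemma ReN z : Re (- z) = - Re z. Proof. by case: z. Qed.
Lemma ReB z w : Re (z - w) = Re z - Re w. Proof. by rewrite ReD ReN. Qed.
Lemma ImD z w : Im (z + w) = Im z + Im w. Proof. by case: z w => [? ?] []. Qed.
Lemma ImN z : Im (- z) = - Im z. Proof. by case: z. Qed.
Lemma ReZ (r : R) z : Re (r%:C * z) = r * Re z.
Proof. by case: z => [? ?]; simpc. Qed.
Lemma ReJ z : Re z^* = Re z. Proof. by case: z. Qed.
Lemma ImJ z : Im z^* = - Im z. Proof. by case: z. Qed.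

Lemma conjc_conjc z : z^*^* = z. Proof. exact: conjcK. Qed.

Lemma conjc_realE (r : R) : r%:C^* = r%:C. Proof. exact: conjc_real. Qed.

Lemma complex_eqP z w : Re z = Re w -> Im z = Im w -> z = w.
Proof. by case: z w => [? ?] [? ?] /= -> ->. Qed.

Lemma normcE_normr z : `|z| = (normc z)%:C. Proof. by []. Qed.

Lemma normc_ge0 z : 0 <= normc z. Proof. by case: z => a b; exact: sqrtr_ge0. Qed.

Lemma normc_sqr z : normc z ^+ 2 = Re z ^+ 2 + Im z ^+ 2.
Proof. by case: z => a b /=; rewrite sqr_sqrtr// addr_ge0// sqr_ge0. Qed.

Lemma normc_sqrE z : z^* * z = (normc z ^+ 2)%:C.
Proof.
by rewrite normc_sqr; case: z => a b; apply: complex_eqP => /=; ring.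
Qed.

Lemma normcJ z : normc z^* = normc z.
Proof. by case: z => a b /=; rewrite sqrrN. Qed.

Lemma normcB z w : normc (z - w) = normc (w - z).
Proof. by rewrite -normcN opprB. Qed.

Lemma le_Re_normc z : `|Re z| <= normc z.
Proof.
rewrite -(@ler_pXn2r _ 2)// ?nnegrE ?normc_ge0// normc_sqr real_normK ?num_real//.
by rewrite lerDl sqr_ge0.
Qed.

Lemma le_Im_normc z : `|Im z| <= normc z.
Proof.
rewrite -(@ler_pXn2r _ 2)// ?nnegrE ?normc_ge0// normc_sqr real_normK ?num_real//.
by rewrite lerDr sqr_ge0.
Qed.

Lemma normc_le_ReIm z : normc z <= `|Re z| + `|Im z|.
Proof.
rewrite -(@ler_pXn2r _ 2)// ?nnegrE ?normc_ge0 ?addr_ge0// normc_sqr sqrrD.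
rewrite !real_normK ?num_real// lerD2r lerDl.
by rewrite mulrn_wge0// mulr_ge0.
Qed.

Lemma normc_real (r : R) : normc r%:C = `|r|.
Proof. by rewrite /= expr0n /= addr0 sqrtr_sqr. Qed.

Lemma ge0_complexE z : 0 <= z -> z = (Re z)%:C.
Proof. by move=> /ger0_Im z0; apply: complex_eqP. Qed.

End ComplexNumbers.

Section InnerProduct.
Context {R : realType}.
Implicit Types H : hilbertType R.

Definition rip H (x y : H) : R := Re (ip x y).

Lemma ipDr H (x y z : H) : ip x (y + z) = ip x y + ip x z.
Proof. by have := ip_linear x 1 y z; rewrite scale1r mul1r. Qed.

Lemma ip0r H (x : H) : ip x 0 = 0.
Proof. by apply: (addrI (ip x 0)); rewrite -ipDr !addr0. Qed.

Lemma ipZr H (x : H) c y : ip x (c *: y) = c * ip x y.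
Proof. by have := ip_linear x c y 0; rewrite !addr0 ip0r addr0. Qed.

Lemma ipNr H (x y : H) : ip x (- y) = - ip x y.
Proof. by rewrite -scaleN1r ipZr mulN1r. Qed.

Lemma ipBr H (x y z : H) : ip x (y - z) = ip x y - ip x z.
Proof. by rewrite ipDr ipNr. Qed.

Lemma ipDl H (x y z : H) : ip (x + y) z = ip x z + ip y z.
Proof. by rewrite ip_conj ipDr rmorphD /= -!ip_conj. Qed.

Lemma ip0l H (x : H) : ip 0 x = 0.
Proof. by rewrite ip_conj ip0r rmorph0. Qed.

Lemma ipZl H c (x y : H) : ip (c *: x) y = c^* * ip x y.
Proof. by rewrite ip_conj ipZr rmorphM /= -ip_conj. Qed.

Lemma ipNl H (x y : H) : ip (- x) y = - ip x y.
Proof. by rewrite ip_conj ipNr rmorphN /= -ip_conj. Qed.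

Lemma ipBl H (x y z : H) : ip (x - y) z = ip x z - ip y z.
Proof. by rewrite ipDl ipNl. Qed.

Lemma ip_sumr H (x : H) I (r : seq I) (F : I -> H) :
  ip x (\sum_(i <- r) F i) = \sum_(i <- r) ip x (F i).
Proof. by apply: (big_morph (ip x) (ipDr x) (ip0r x)). Qed.

Lemma ip_suml H (x : H) I (r : seq I) (F : I -> H) :
  ip (\sum_(i <- r) F i) x = \sum_(i <- r) ip (F i) x.
Proof.
by apply: (big_morph (fun y => ip y x) (fun y z => ipDl y z x) (ip0l x)).
Qed.

Lemma rnormE (V : normedModType R[i]) (x : V) : `|x| = (rnorm x)%:C.
Proof. by apply: ge0_complexE. Qed.

Lemma rnorm_ge0 (V : normedModType R[i]) (x : V) : 0 <= rnorm x.
Proof. by have := normr_ge0 x; rewrite rnormE lecR. Qed.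

Lemma rnorm0 (V : normedModType R[i]) : rnorm (0 : V) = 0.
Proof. by rewrite /rnorm normr0. Qed.

Lemma rnorm_eq0 (V : normedModType R[i]) (x : V) : rnorm x = 0 -> x = 0.
Proof. by move=> x0; apply/eqP; rewrite -normr_eq0 rnormE x0. Qed.

Lemma rnormN (V : normedModType R[i]) (x : V) : rnorm (- x) = rnorm x.
Proof. by rewrite /rnorm normrN. Qed.

Lemma rnormB (V : normedModType R[i]) (x y : V) : rnorm (x - y) = rnorm (y - x).
Proof. by rewrite -rnormN opprB. Qed.

Lemma ler_rnormD (V : normedModType R[i]) (x y : V) :
  rnorm (x + y) <= rnorm x + rnorm y.
Proof. by have := ler_normD x y; rewrite !rnormE -rmorphD /= lecR. Qed.

Lemma rnormZ (V : normedModType R[i]) c (x : V) :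
  rnorm (c *: x) = normc c * rnorm x.
Proof. by apply: complexI; rewrite -rnormE normrZ !rnormE -rmorphM. Qed.

Lemma ipxx H (x : H) : ip x x = (rnorm x ^+ 2)%:C.
Proof. by rewrite -ip_norm rnormE -rmorphXn. Qed.

Lemma ripxx H (x : H) : rip x x = rnorm x ^+ 2.
Proof. by rewrite /rip ipxx. Qed.

Lemma ripC H (x y : H) : rip x y = rip y x.
Proof. by rewrite /rip ip_conj ReJ. Qed.

Lemma ripDr H (x y z : H) : rip x (y + z) = rip x y + rip x z.
Proof. by rewrite /rip ipDr ReD. Qed.
Lemma ripDl H (x y z : H) : rip (x + y) z = rip x z + rip y z.
Proof. by rewrite /rip ipDl ReD. Qed.
Lemma ripNr H (x y : H) : rip x (- y) = - rip x y.
Proof. by rewrite /rip ipNr ReN. Qed.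
Lemma ripNl H (x y : H) : rip (- x) y = - rip x y.
Proof. by rewrite /rip ipNl ReN. Qed.
Lemma ripZr H (r : R) (x y : H) : rip x (r%:C *: y) = r * rip x y.
Proof. by rewrite /rip ipZr ReZ. Qed.
Lemma ripZl H (r : R) (x y : H) : rip (r%:C *: x) y = r * rip x y.
Proof. by rewrite ripC ripZr ripC. Qed.
Lemma rip0r H (x : H) : rip x 0 = 0. Proof. by rewrite /rip ip0r. Qed.

Lemma rnormD_sqr H (x y : H) :
  rnorm (x + y) ^+ 2 = rnorm x ^+ 2 + 2 * rip x y + rnorm y ^+ 2.
Proof. by rewrite -!ripxx ripDl !ripDr (ripC y x); ring. Qed.

Lemma rnormB_sqr H (x y : H) :
  rnorm (x - y) ^+ 2 = rnorm x ^+ 2 - 2 * rip x y + rnorm y ^+ 2.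
Proof. by rewrite rnormD_sqr rnormN ripNr; ring. Qed.

Lemma rip_le H (x y : H) : rip x y <= rnorm x * rnorm y.
Proof.
have [x0|xn0] := eqVneq (rnorm x) 0.
  by rewrite (rnorm_eq0 x0) ripC rip0r rnorm0 mul0r.
have [y0|yn0] := eqVneq (rnorm y) 0.
  by rewrite (rnorm_eq0 y0) rip0r rnorm0 mulr0.
have := sqr_ge0 (rnorm ((rnorm y)%:C *: x - (rnorm x)%:C *: y)).
rewrite rnormB_sqr ripZl ripZr !rnormZ !normc_real !ger0_norm ?rnorm_ge0//.
have x0 : 0 < rnorm x by rewrite lt_neqAle eq_sym xn0 rnorm_ge0.
have y0 : 0 < rnorm y by rewrite lt_neqAle eq_sym yn0 rnorm_ge0.
have -> : (rnorm y * rnorm x) ^+ 2 - 2 * (rnorm y * (rnorm x * rip x y)) +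
  (rnorm x * rnorm y) ^+ 2 = 2 * (rnorm y * rnorm x) * (rnorm x * rnorm y - rip x y).
  by ring.
by rewrite pmulr_rge0 ?subr_ge0// !mulr_gt0.
Qed.

Lemma normc_ip_le H (x y : H) : normc (ip x y) <= rnorm x * rnorm y.
Proof.
set z := ip x y; have [->|z0] := eqVneq (normc z) 0.
  by rewrite mulr_ge0 ?rnorm_ge0.
have zp : 0 < normc z by rewrite lt_neqAle eq_sym z0 normc_ge0.
rewrite -(ler_pM2l zp) -expr2.
have -> : normc z ^+ 2 = rip x (z^* *: y).
  by rewrite /rip ipZr normc_sqrE.
by apply: le_trans (rip_le _ _) _; rewrite rnormZ normcJ mulrCA.
Qed.

(** Rotating [y] by ['i] turns the imaginary part into a real one, so the Riesz vector and
    isometries can be treated with the real form [rip]. *)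
Lemma ip_polarization H (x y : H) :
  ip x y = (rip x y)%:C - (rip x ('i *: y))%:C * 'i.
Proof.
by rewrite /rip ipZr; case: (ip x y) => a b; apply: complex_eqP => /=; ring.
Qed.

Lemma ip_eq0l H (x : H) : (forall y, ip y x = 0) -> x = 0.
Proof.
move=> /(_ x); rewrite ipxx => /complexI /eqP; rewrite sqrf_eq0 => /eqP.
exact: rnorm_eq0.
Qed.

End InnerProduct.

(** * The Riesz representation theorem *)

Section Completeness.
Context {R : realType}.

Definition cauchy_sequence (V : normedModType R[i]) (u : nat -> V) : Prop :=
  forall e : R, 0 < e -> exists N, forall m n, (N <= m)%N -> (N <= n)%N ->
    rnorm (u m - u n) < e.

Lemma gt0_complexP (e : R[i]) : 0 < e -> exists2 r : R, 0 < r & e = r%:C.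
Proof.
move=> e0; exists (Re e); last exact/ge0_complexE/ltW.
by move: e0; rewrite ltcE => /andP[_].
Qed.

Lemma cauchy_sequence_cvg (V : completeNormedModType R[i]) (u : nat -> V) :
  cauchy_sequence u -> exists l : V, forall e : R, 0 < e ->
    exists N, forall n, (N <= n)%N -> rnorm (u n - l) < e.
Proof.
move=> cu; have : cvg (u @ \oo).
  apply: cauchy_cvg; apply: cauchy_exP => e /gt0_complexP[r r0 ->].
  have [N HN] := cu r r0; exists (u N); exists N => // n /= Nn.
  by rewrite -ball_normE /ball_/= rnormE ltcR HN.
move=> /cvg_ex[l /cvgrPdist_lt ul]; exists l => e e0.
have /ul[N _ HN] : 0 < e%:C by rewrite ltcR.
by exists N => n Nn; move: (HN n Nn) => /=; rewrite rnormE ltcR rnormB.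
Qed.

Lemma archi_inv (e : R) : 0 < e ->
  exists N, forall n, (N <= n)%N -> harmonic n < e.
Proof.
move=> e0; exists (Num.truncn e^-1) => n Nn.
rewrite -(invrK e) ltf_pV2 ?posrE ?invr_gt0//.
by rewrite (lt_le_trans (truncnS_gt _)) ?ler_nat.
Qed.

(** The constant [c] is arbitrary, so limit arguments may end with an unnormalised multiple of
    [harmonic n]. *)
Lemma le_of_forall_inv (x y c : R) :
  (forall n : nat, x <= y + c * harmonic n) -> x <= y.
Proof.
move=> h; rewrite leNgt; apply/negP => yx.
have c1 : 0 < `|c| + 1 by rewrite ltr_wpDl.
have e0 : 0 < (x - y) / (`|c| + 1) by rewrite divr_gt0// subr_gt0.
have [N /(_ N (leqnn N))] := archi_inv e0.
rewrite ltr_pdivlMr// => HN; have := h N.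
have : c * harmonic N <= harmonic N * (`|c| + 1).
  rewrite mulrC ler_wpM2l// ?invr_ge0//.
  by rewrite (le_trans (ler_norm c))// lerDl.
lra.
Qed.

End Completeness.

Section Combinations.
Context {R : realType} {I : Type}.
Implicit Types s t : seq (R[i] * I).

(** Combinations are lists rather than finitely supported functions: repeated indices are harmless
    and [I] can be any type. *)
Definition lcomb (V : lmodType R[i]) (T : I -> V) s : V :=
  \sum_(p <- s) p.1 *: T p.2.

Definition scomb (c : I -> R[i]) s : R[i] := \sum_(p <- s) p.1 * c p.2.

Definition cscale (a : R[i]) s := [seq (a * p.1, p.2) | p <- s].

Lemma lcomb_cat (V : lmodType R[i]) (T : I -> V) s t :
  lcomb T (s ++ t) = lcomb T s + lcomb T t.
Proof. exact: big_cat. Qed.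

Lemma lcomb_scale (V : lmodType R[i]) (T : I -> V) a s :
  lcomb T (cscale a s) = a *: lcomb T s.
Proof.
rewrite /lcomb big_map scaler_sumr.
by apply: eq_bigr => p _; rewrite scalerA.
Qed.

Lemma lcomb1 (V : lmodType R[i]) (T : I -> V) i : lcomb T [:: (1, i)] = T i.
Proof. by rewrite /lcomb big_seq1 scale1r. Qed.

Lemma scomb_cat c s t : scomb c (s ++ t) = scomb c s + scomb c t.
Proof. exact: big_cat. Qed.

Lemma scomb_scale c a s : scomb c (cscale a s) = a * scomb c s.
Proof.
rewrite /scomb big_map mulr_sumr.
by apply: eq_bigr => p _; rewrite mulrA.
Qed.

Lemma ip_lcombr (K : hilbertType R) (x : K) (T : I -> K) s :
  ip x (lcomb T s) = scomb (fun i => ip x (T i)) s.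
Proof. by rewrite /lcomb ip_sumr; apply: eq_bigr => p _; rewrite ipZr. Qed.

Lemma lcomb_linear (V W : lmodType R[i]) (A : V -> W) (T : I -> V) s :
  linear A -> A (lcomb T s) = lcomb (A \o T) s.
Proof.
move=> lA; have A0 : A 0 = 0.
  by have := lA (-1) 0 0; rewrite scaleN1r addNr scaleN1r addNr.
elim: s => [|p s IH]; first by rewrite /lcomb !big_nil.
by rewrite /lcomb !big_cons lA -/(lcomb T s) IH.
Qed.

(** This is the closed linear span. *)
Definition in_span (K : normedModType R[i]) (T : I -> K) (x : K) : Prop :=
  forall e : R, 0 < e -> exists s, rnorm (x - lcomb T s) < e.

(** Phrased by the orthogonal complement instead of density, the form in which vectors coming from
    [riesz] are compared. *)
Definition total (K : hilbertType R) (T : I -> K) : Prop :=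
  forall x, (forall i, ip x (T i) = 0) -> x = 0.

Lemma in_span_orthogonal (K : hilbertType R) (T : I -> K) x y :
  in_span T x -> (forall i, ip y (T i) = 0) -> ip y x = 0.
Proof.
move=> Tx yT; apply: eq0_normc; apply/eqP; rewrite eq_le normc_ge0 andbT.
apply: (@le_of_forall_inv _ _ _ (rnorm y)) => n.
have [|s xs] := Tx (harmonic n); first exact: harmonic_gt0.
have -> : ip y x = ip y (x - lcomb T s).
  rewrite ipBr ip_lcombr /scomb big1 ?subr0// => p _.
  by rewrite yT mulr0.
rewrite add0r (le_trans (normc_ip_le _ _))// ler_wpM2l ?rnorm_ge0//.
exact: ltW.
Qed.

(* The representing vector minimises |v|^2 - 2 Re f(v) over the span. *)
Theorem riesz (K : hilbertType R) (T : I -> K) (c : I -> R[i]) (r : R) :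
  0 <= r -> (forall s, normc (scomb c s) <= r * rnorm (lcomb T s)) ->
  exists x : K, [/\ forall i, ip x (T i) = c i, in_span T x & rnorm x <= r].
Proof.
move=> r0 cT.
pose J s := rnorm (lcomb T s) ^+ 2 - 2 * Re (scomb c s).
have Re_le s : Re (scomb c s) <= r * rnorm (lcomb T s).
  exact: le_trans (le_trans (ler_norm _) (le_Re_normc _)) (cT s).
(* Completing the square: J is at least |v|^2 - 2 r |v|. *)
have JB s : - r ^+ 2 <= J s.
  rewrite /J; have := Re_le s; have := sqr_ge0 (rnorm (lcomb T s) - r); nra.
pose E := [set J s | s in setT].
have hE : has_inf E.
  split; first by exists (J [::]), [::].
  by exists (- r ^+ 2) => _ [s _ <-].
pose d := inf E.
have dJ s : d <= J s by apply: ge_inf; [case: hE|exists s].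
have /choice[s_ s_P] : forall n : nat, exists s, J s < d + harmonic n.
  move=> n; have [|_ [s _ <-] Js] := @inf_adherent _ E (harmonic n) _ hE.
    exact: harmonic_gt0.
  by exists s.
pose v n := lcomb T (s_ n).
(* The midpoint of two almost minimisers is again a competitor, and the parallelogram law then makes
   the minimising sequence Cauchy. *)
have mid m n : rnorm (v m - v n) ^+ 2 <= 2 * harmonic m + 2 * harmonic n.
  have := dJ (cscale (1 / 2)%:C (s_ m ++ s_ n)).
  rewrite {1}/J lcomb_scale scomb_scale lcomb_cat scomb_cat -/(v m) -/(v n).
  rewrite ReZ ReD rnormZ exprMn normc_real real_normK ?num_real//.
  rewrite rnormD_sqr rnormB_sqr.
  have := s_P m; have := s_P n; rewrite /J -/(v m) -/(v n); lra.
have [x vx] : exists x : K, forall e : R, 0 < e ->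
    exists N, forall n, (N <= n)%N -> rnorm (v n - x) < e.
  apply: cauchy_sequence_cvg => e e0.
  have [|N HN] := @archi_inv _ (e ^+ 2 / 4); first by rewrite divr_gt0 ?exprn_gt0.
  exists N => m n Nm Nn; rewrite -(@ltr_pXn2r _ 2) ?nnegrE ?rnorm_ge0 ?(ltW e0)//.
  by apply: le_lt_trans (mid m n) _; have := HN _ Nm; have := HN _ Nn; lra.
have vxn (n : nat) : exists m, (n <= m)%N /\ rnorm (v m - x) < harmonic n.
  have [|N HN] := vx (harmonic n); first exact: harmonic_gt0.
  by exists (maxn n N); rewrite leq_maxl HN ?leq_maxr.
(* The variation of J at the limit [x] in the direction of [s]. Since [x] need not be a finite
   combination, the inequality is proved at [v m] and passed to the limit. *)
have var s (t : R) :
    0 <= t ^+ 2 * rnorm (lcomb T s) ^+ 2 + 2 * t * (rip x (lcomb T s) - Re (scomb c s)).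
  set w := lcomb T s; set D := rip x w - _.
  apply: (@le_of_forall_inv _ _ _ (1 + 2 * `|t| * rnorm w)) => n.
  have [m [nm vm]] := vxn n.
  have := dJ (s_ m ++ cscale t%:C s).
  rewrite {1}/J lcomb_cat scomb_cat lcomb_scale scomb_scale -/(v m) -/w.
  rewrite rnormD_sqr ripZr rnormZ exprMn normc_real real_normK ?num_real//.
  rewrite ReD ReZ.
  have := s_P m; rewrite /J -/(v m).
  have : harmonic m <= harmonic n :> R by rewrite lef_pV2 ?posrE// ler_nat.
  have -> : rip (v m) w = rip x w + rip (v m - x) w.
    by rewrite -ripDl addrC subrK.
  have : t * rip (v m - x) w <= `|t| * rnorm w * harmonic n.
    have h : `|rip (v m - x) w| <= rnorm w * harmonic n.
      apply: le_trans (le_Re_normc _) _.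
      apply: le_trans (normc_ip_le _ _) _; rewrite mulrC ler_wpM2l ?rnorm_ge0//.
      exact: ltW.
    apply: le_trans (ler_norm _) _.
    by rewrite normrM -mulrA ler_wpM2l.
  rewrite /D; lra.
have ReE s : rip x (lcomb T s) = Re (scomb c s).
  apply/eqP; rewrite -subr_eq0; set D := _ - _; apply/eqP.
  set q := rnorm (lcomb T s) ^+ 2.
  have q0 : 0 <= q by apply: sqr_ge0.
  (* The optimal step is -D / q; adding 1 avoids a zero denominator and still gives a negative value
     unless D = 0. *)
  have := var s (- D / (q + 1)); rewrite -/D -/q.
  have -> : (- D / (q + 1)) ^+ 2 * q + 2 * (- D / (q + 1)) * D =
     - (D ^+ 2 * ((q + 2) / (q + 1) ^+ 2)) by field; lra.
  rewrite oppr_ge0 pmulr_lle0; last by rewrite divr_gt0 ?exprn_gt0//; lra.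
  by move=> D0; apply/eqP; rewrite -sqrf_eq0 eq_le D0 sqr_ge0.
exists x; split.
- move=> i; have := ReE [:: (1, i)]; have := ReE [:: ('i, i)].
  rewrite /lcomb /scomb !big_seq1/= scale1r mul1r => h1 h2.
  rewrite ip_polarization h1 h2.
  by case: (c i) => a b; apply: complex_eqP => /=; ring.
- move=> e e0; have [N HN] := vx e e0; exists (s_ N).
  by rewrite rnormB HN.
- have [->//|xn0] := eqVneq (rnorm x) 0.
  have x0 : 0 < rnorm x by rewrite lt_neqAle eq_sym xn0 rnorm_ge0.
  rewrite -(ler_pM2l x0).
  apply: (@le_of_forall_inv _ _ _ (rnorm x + r)) => n.
  have [m [nm vm]] := vxn n.
  rewrite -expr2 -ripxx.
  have -> : rip x x = rip x (v m) - rip x (v m - x).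
    by rewrite ripDr ripNr; ring.
  rewrite ReE.
  have h1 := Re_le (s_ m); rewrite -/(v m) in h1.
  have h2 : rnorm (v m) <= rnorm x + harmonic n.
    have -> : v m = x + (v m - x) by rewrite addrC subrK.
    by apply: le_trans (ler_rnormD _ _) _; rewrite lerD2l ltW.
  have h3 : - rip x (v m - x) <= rnorm x * harmonic n.
    rewrite -ripNr; apply: le_trans (rip_le _ _) _.
    by rewrite rnormN ler_wpM2l ?rnorm_ge0// ltW.
  have h4 : r * rnorm (v m) <= r * (rnorm x + harmonic n) by rewrite ler_wpM2l.
  lra.
Qed.

End Combinations.

(** * Operators on Hilbert spaces *)

Section LinearMaps.
Context {R : realType} {V W : lmodType R[i]} (T : V -> W).
Context (lT : linear T).

Lemma lin0 : T 0 = 0.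
Proof. by have := lT (-1) 0 0; rewrite scaleN1r addNr scaleN1r addNr. Qed.

Lemma linD x y : T (x + y) = T x + T y.
Proof. by have := lT 1 x y; rewrite !scale1r. Qed.

Lemma linZ c x : T (c *: x) = c *: T x.
Proof. by have := lT c x 0; rewrite !addr0 lin0 addr0. Qed.

Lemma linN x : T (- x) = - T x.
Proof. by rewrite -scaleN1r linZ scaleN1r. Qed.

Lemma linB x y : T (x - y) = T x - T y.
Proof. by rewrite linD linN. Qed.

Lemma lin_sum I (r : seq I) (F : I -> V) :
  T (\sum_(i <- r) F i) = \sum_(i <- r) T (F i).
Proof. exact: (big_morph T linD lin0). Qed.

End LinearMaps.

Section Operators.
Context {R : realType}.
Implicit Types (H K V W : hilbertType R) (I : Type).

Lemma bounded_linear_ge0 (V W : normedModType R[i]) (T : V -> W) :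
  bounded_linear T ->
  exists2 r : R, 0 <= r & forall x, rnorm (T x) <= r * rnorm x.
Proof.
move=> [_ [r rT]]; exists `|r| => // x; apply: le_trans (rT x) _.
by rewrite ler_wpM2r ?rnorm_ge0// ler_norm.
Qed.

Lemma ip_ext H (x y : H) : (forall z, ip x z = ip y z) -> x = y.
Proof.
move=> xy; apply/eqP; rewrite -subr_eq0; apply/eqP; apply: ip_eq0l => z.
by rewrite ip_conj ipBl xy subrr rmorph0.
Qed.

Lemma ip_extr H (x y : H) : (forall z, ip z x = ip z y) -> x = y.
Proof. by move=> xy; apply: ip_ext => z; rewrite ip_conj xy -ip_conj. Qed.

Lemma total_ext I K (T : I -> K) x y :
  total T -> (forall i, ip x (T i) = ip y (T i)) -> x = y.
Proof.
move=> tT xy; apply/eqP; rewrite -subr_eq0; apply/eqP; apply: tT => i.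
by rewrite ipBl xy subrr.
Qed.

Lemma adjoint_exists V W (T : V -> W) : bounded_linear T ->
  exists S : W -> V, bounded_linear S /\ forall x y, ip (T x) y = ip x (S y).
Proof.
move=> bT; have [r r0 rT] := bounded_linear_ge0 bT; have lT := bT.1.
have /choice[S SP] : forall y : W, exists z : V,
    (forall v, ip z v = ip y (T v)) /\ rnorm z <= r * rnorm y.
  move=> y; have [|s|z [zP _ zr]] := @riesz R V V id (fun v => ip y (T v)) (r * rnorm y).
  - by rewrite mulr_ge0 ?rnorm_ge0.
  - rewrite -(ip_lcombr y T) -(lcomb_linear id _ lT).
    rewrite (le_trans (normc_ip_le _ _))// mulrC mulrAC ler_wpM2r ?rnorm_ge0//.
  - by exists z.
exists S; split; last first.
  by move=> x y; rewrite ip_conj -(SP y).1 -ip_conj.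
split; last by exists r => y; exact: (SP y).2.
move=> c y z; apply: ip_ext => v; rewrite ipDl ipZl !(SP _).1.
by rewrite ipDl ipZl.
Qed.

(** Totality only sees inner products, so both operators are moved to the other side by their
    adjoints. *)
Lemma eq_on_total I V W (T : I -> V) (A B : V -> W) : total T ->
  bounded_linear A -> bounded_linear B -> (forall i, A (T i) = B (T i)) ->
  forall x, A x = B x.
Proof.
move=> tT /adjoint_exists[A' [_ A'P]] /adjoint_exists[B' [_ B'P]] AB x.
apply: ip_ext => y; rewrite A'P B'P; congr ip.
apply: (total_ext tT) => i.
by rewrite ip_conj -A'P AB B'P -ip_conj.
Qed.

Lemma bounded_linear_comp (U V W : normedModType R[i]) (A : V -> W) (B : U -> V) :
  bounded_linear A -> bounded_linear B -> bounded_linear (A \o B).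
Proof.
move=> bA bB; split.
  by move=> c x y /=; rewrite bB.1 bA.1.
have [r r0 rA] := bounded_linear_ge0 bA; have [s s0 sB] := bounded_linear_ge0 bB.
exists (r * s) => x /=; rewrite (le_trans (rA _))// -mulrA ler_wpM2l//.
Qed.

Lemma unitary_rnorm V W (u : V -> W) x : unitary u -> rnorm (u x) = rnorm x.
Proof.
move=> [_ uip _]; apply/eqP; rewrite -(@eqrXn2 _ 2) ?rnorm_ge0//.
by rewrite -!ripxx /rip uip.
Qed.

Lemma unitary_bounded V W (u : V -> W) : unitary u -> bounded_linear u.
Proof.
by move=> uu; split; [case: uu|exists 1 => x; rewrite (unitary_rnorm _ uu) mul1r].
Qed.

Lemma isometry_ip V W (u : V -> W) : linear u ->
  (forall x, rnorm (u x) = rnorm x) -> forall x y, ip (u x) (u y) = ip x y.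
Proof.
move=> lu nu; have ru x y : rip (u x) (u y) = rip x y.
  have := nu (x + y); move/(congr1 (fun t => t ^+ 2)).
  by rewrite (linD lu) !rnormD_sqr !nu; lra.
by move=> x y; rewrite ip_polarization -(linZ lu) !ru -ip_polarization.
Qed.

Lemma rnorm_lcomb_gram I V W (T : I -> V) (S : I -> W) s :
  (forall i j, ip (T i) (T j) = ip (S i) (S j)) ->
  rnorm (lcomb T s) = rnorm (lcomb S s).
Proof.
move=> TS; apply/eqP; rewrite -(@eqrXn2 _ 2) ?rnorm_ge0// -!ripxx /rip.
rewrite !ip_suml; apply/eqP; congr Re; apply: eq_bigr => p _.
rewrite !ip_sumr; apply: eq_bigr => q _.
by rewrite !ipZl !ipZr TS.
Qed.

(** The map [u] is the adjoint of the isometry T i |-> S i. Building the adjoint first makes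
    well-definedness on combinations part of the Riesz bound. *)
Lemma contraction_extension I V W (T : I -> V) (S : I -> W) : total T ->
  (forall i j, ip (T i) (T j) = ip (S i) (S j)) ->
  exists u : W -> V, [/\ linear u, forall x, rnorm (u x) <= rnorm x &
    forall x i, ip (u x) (T i) = ip x (S i)].
Proof.
move=> tT TS; have /choice[u uP] : forall y : W, exists z : V,
    (forall i, ip z (T i) = ip y (S i)) /\ rnorm z <= rnorm y.
  move=> y; have [||z [zP _ zr]] := @riesz R I V T (fun i => ip y (S i)) (rnorm y).
  - exact: rnorm_ge0.
  - move=> s; rewrite -(ip_lcombr y S) (rnorm_lcomb_gram _ TS).
    exact: normc_ip_le.
  - by exists z.
exists u; split.
- move=> c x y; apply: (total_ext tT) => i.
  by rewrite ipDl ipZl !(uP _).1 ipDl ipZl.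
- by move=> x; exact: (uP x).2.
- by move=> x; exact: (uP x).1.
Qed.

(** The contractions obtained for both directions act on the families as expected and are mutually
    inverse, so each is isometric. *)
Theorem unitary_extension I V W (T : I -> V) (S : I -> W) :
  total T -> total S -> (forall i j, ip (T i) (T j) = ip (S i) (S j)) ->
  exists u : V -> W, exists v : W -> V,
    [/\ unitary u, unitary v, forall i, u (T i) = S i, forall i, v (S i) = T i &
        (forall x, v (u x) = x) /\ (forall y, u (v y) = y)].
Proof.
move=> tT tS TS.
have ST i j : ip (S i) (S j) = ip (T i) (T j) by rewrite TS.
have [v [lv nv vP]] := contraction_extension tT TS.
have [u [lu nu uP]] := contraction_extension tS ST.
have uT i : u (T i) = S i by apply: (total_ext tS) => j; rewrite uP TS.
have vS i : v (S i) = T i by apply: (total_ext tT) => j; rewrite vP TS.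
have vu x : v (u x) = x by apply: (total_ext tT) => j; rewrite vP uP.
have uv y : u (v y) = y by apply: (total_ext tS) => j; rewrite uP vP.
have nuE x : rnorm (u x) = rnorm x.
  by apply/eqP; rewrite eq_le nu -{1}(vu x) nv.
have nvE x : rnorm (v x) = rnorm x.
  by apply/eqP; rewrite eq_le nv -{1}(uv x) nu.
exists u, v; split=> //; split=> //.
- exact: isometry_ip.
- by move=> y; exists (v y).
- exact: isometry_ip.
- by move=> y; exists (u y).
Qed.

(* Iterating a_n^2 <= a_0 a_2n along powers of two, exponential growth of rate
   [r] forces the first step to grow at rate at most [r]. *)
Lemma le_growth (a : nat -> R) (C r : R) : 0 < r -> 0 <= a 0%N ->
  (forall n, a n ^+ 2 <= a 0%N * a n.*2) -> (forall n, a n <= C * r ^+ n) ->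
  a 1%N <= r * a 0%N.
Proof.
move=> r0 a00 aa aC; rewrite leNgt; apply/negP => ra.
have [a0|a0] := eqVneq (a 0%N) 0.
  move: ra (aa 1%N); rewrite a0 mulr0 mul0r => a1.
  by rewrite leNgt exprn_gt0.
have a0p : 0 < a 0%N by rewrite lt_neqAle eq_sym a0.
(* The relative excess of [a 1] over [r * a 0]; if positive, it contradicts [aC] by Bernoulli's
   inequality. *)
pose q := a 1%N / (r * a 0%N) - 1.
have q0 : 0 < q by rewrite subr_gt0 ltr_pdivlMr ?mulr_gt0// mul1r.
have aq : a 1%N = a 0%N * (r * (1 + q)).
  by rewrite /q addrC subrK; field; rewrite a0 gt_eqF.
have rq0 : 0 < r * (1 + q) by rewrite mulr_gt0// addr_gt0.
have h j : a 0%N * (r * (1 + q)) ^+ (2 ^ j) <= a (2 ^ j)%N.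
  elim: j => [|j IH]; first by rewrite expn0 expr1 aq.
  rewrite -(ler_pM2l a0p) expnS mul2n.
  apply: le_trans (aa _).
  apply: le_trans (_ : (a 0%N * (r * (1 + q)) ^+ (2 ^ j)) ^+ 2 <= _).
    by rewrite -addnn exprD le_eqVlt; apply/orP; left; apply/eqP; ring.
  have z0 : 0 <= a 0%N * (r * (1 + q)) ^+ (2 ^ j).
    by rewrite mulr_ge0// exprn_ge0// ltW.
  by rewrite ler_pXn2r// nnegrE (le_trans z0).
have bern k : 1 + k%:R * q <= (1 + q) ^+ k.
  elim: k => [|k IH]; first by rewrite mul0r addr0 expr0.
  rewrite exprS -natr1.
  have : 0 <= k%:R * q * q by rewrite !mulr_ge0 ?(ltW q0).
  have : 0 <= (1 + q) * ((1 + q) ^+ k - (1 + k%:R * q)).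
    by rewrite mulr_ge0 ?subr_ge0// addr_ge0// ltW.
  nra.
have aCq j : a 0%N * (1 + j%:R * q) <= C.
  have := le_trans (h j) (aC _); rewrite exprMn mulrCA mulrC.
  rewrite ler_pM2r ?exprn_gt0//; apply: le_trans; rewrite ler_pM2l//.
  apply: le_trans (bern _); rewrite lerD2l ler_pM2r// ler_nat.
  exact/ltnW/ltn_expl.
have aq0 : 0 < a 0%N * q by rewrite mulr_gt0.
have := aCq (Num.truncn (C / (a 0%N * q))).+1.
have := truncnS_gt (C / (a 0%N * q)).
rewrite ltr_pdivrMr// => C1; rewrite leNgt => /negP; apply.
by apply: lt_le_trans C1 _; rewrite [leRHS]mulrDr [a 0%N * 1]mulr1 mulrCA lerDr.
Qed.

(* T (p i) and T (q i) are the images of T i under an operator and its formal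
   adjoint Q; the powers of Q^* Q, that is the iterates of [p \o q], control the
   norm of Q. *)
Theorem adjointable_extension I K (T : I -> K) (p q : I -> I) (r : R) :
  total T -> 0 <= r ->
  (forall i j, ip (T (p i)) (T j) = ip (T i) (T (q j))) ->
  (forall i j, exists C, forall n, normc (ip (T i) (T (iter n (p \o q) j))) <= C * r ^+ n) ->
  exists L : K -> K, bounded_linear L /\
    (forall x j, ip (L x) (T j) = ip x (T (q j))).
Proof.
move=> tT r0 pq growth.
have qp i j : ip (T (q i)) (T j) = ip (T i) (T (p j)).
  by rewrite ip_conj -pq -ip_conj.
have sym n i j : ip (T (iter n (p \o q) i)) (T j) = ip (T i) (T (iter n (p \o q) j)).
  elim: n i j => [//|n IH] i j.
  by rewrite [iter n.+1 _ j]iterSr -IH iterS /= pq qp.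
pose it n (s : seq (R[i] * I)) := [seq (x.1, iter n (p \o q) x.2) | x <- s].
have itE n s : lcomb T (it n s) = lcomb (T \o iter n (p \o q)) s.
  by rewrite /lcomb big_map.
have ipE (U U' : I -> K) s t : ip (lcomb U s) (lcomb U' t) =
    \sum_(x <- s) \sum_(y <- t) x.1^* * (y.1 * ip (U x.2) (U' y.2)).
  rewrite ip_suml; apply: eq_bigr => x _; rewrite ip_sumr.
  by apply: eq_bigr => y _; rewrite ipZl ipZr.
(* The rate is [r + 1] because [le_growth] asks for a strictly positive one. *)
have bound s : rnorm (lcomb (T \o q) s) ^+ 2 <= (r + 1) * rnorm (lcomb T s) ^+ 2.
  pose a n := rip (lcomb T s) (lcomb (T \o iter n (p \o q)) s).
  have a0 : a 0%N = rnorm (lcomb T s) ^+ 2 by rewrite -ripxx.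
  have a1 : a 1%N = rnorm (lcomb (T \o q) s) ^+ 2.
    rewrite -ripxx /a /rip !ipE; congr Re.
    by apply: eq_bigr => x _; apply: eq_bigr => y _; rewrite /= qp.
  rewrite -a0 -a1.
  have [C aC] : exists C, forall n, a n <= C * (r + 1) ^+ n.
    have /choice[Cf CfP] := fun ij : I * I => growth ij.1 ij.2.
    exists (\sum_(x <- s) \sum_(y <- s) normc x.1 * (normc y.1 * `|Cf (x.2, y.2)|)) => n.
    apply: le_trans (ler_norm _) _; apply: le_trans (le_Re_normc _) _.
    rewrite ipE; elim/big_ind2 : _ => [|x1 x2 y1 y2 h1 h2|x _].
    - by rewrite mul0r normc0.
    - by rewrite mulrDl (le_trans (le_normcD _ _))// lerD.
    elim/big_ind2 : _ => [|x1 x2 y1 y2 h1 h2|y _].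
    - by rewrite mul0r normc0.
    - by rewrite mulrDl (le_trans (le_normcD _ _))// lerD.
    rewrite !normcM normcJ -!mulrA ler_wpM2l ?normc_ge0// ler_wpM2l ?normc_ge0//.
    apply: le_trans (CfP (x.2, y.2) n) _.
    apply: le_trans (_ : `|Cf (x.2, y.2)| * r ^+ n <= _).
      by rewrite ler_wpM2r ?exprn_ge0// ler_norm.
    by rewrite ler_wpM2l// lerXn2r ?nnegrE ?addr_ge0// lerDl.
  (* By symmetry of [p \o q], [a n.*2] is the squared norm of the n-th iterate, and the required
     inequality is Cauchy-Schwarz. *)
  apply: (@le_growth a C); rewrite ?a0 ?sqr_ge0// ?ltr_wpDl// => n.
  have -> : rnorm (lcomb T s) ^+ 2 * a n.*2 =
     rnorm (lcomb T s) ^+ 2 * rnorm (lcomb (T \o iter n (p \o q)) s) ^+ 2.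
    congr (_ * _); rewrite -ripxx /a /rip !ipE; congr Re.
    by apply: eq_bigr => x _; apply: eq_bigr => y _; rewrite /= sym -iterD addnn.
  rewrite -exprMn /a -real_normK ?num_real// lerXn2r ?nnegrE ?mulr_ge0 ?rnorm_ge0//.
  exact: le_trans (le_Re_normc _) (normc_ip_le _ _).
(* As r + 1 >= 1, the constant bounds its own square root. *)
have boundS s : rnorm (lcomb (T \o q) s) <= (r + 1) * rnorm (lcomb T s).
  rewrite -(@ler_pXn2r _ 2) ?nnegrE ?mulr_ge0 ?rnorm_ge0 ?addr_ge0//.
  apply: le_trans (bound s) _; rewrite exprMn ler_wpM2r ?sqr_ge0//.
  by rewrite expr2 ler_peMl ?addr_ge0// lerDr.
have /choice[L LP] : forall x : K, exists z : K,
    (forall j, ip z (T j) = ip x (T (q j))) /\ rnorm z <= rnorm x * (r + 1).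
  move=> x; have [||z [zP _ zr]] := @riesz R I K T (fun j => ip x (T (q j))) (rnorm x * (r + 1)).
  - by rewrite mulr_ge0 ?rnorm_ge0 ?addr_ge0.
  - move=> s; rewrite -(ip_lcombr x (T \o q)) -mulrA.
    apply: le_trans (normc_ip_le _ _) _.
    by rewrite ler_wpM2l ?rnorm_ge0.
  - by exists z.
exists L; split; last by move=> x; exact: (LP x).1.
split; last by exists (r + 1) => x; rewrite mulrC; exact: (LP x).2.
move=> c x y; apply: (total_ext tT) => i.
by rewrite ipDl ipZl !(LP _).1 ipDl ipZl.
Qed.

End Operators.

(** * Von Neumann algebras and matrix positivity *)

Section VonNeumannAlgebras.
Context {R : realType} {H : hilbertType R}.
Implicit Types (M : vonNeumannAlgebra H) (a b T S : H -> H).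

Lemma opnorm_has_inf T : bounded_linear T ->
  has_inf [set r : R | 0 <= r /\ forall x : H, rnorm (T x) <= r * rnorm x].
Proof.
move=> /bounded_linear_ge0[r r0 rT]; split; first by exists r.
by exists 0 => x [].
Qed.

Lemma opnorm_ge0 T : bounded_linear T -> 0 <= opnorm T.
Proof. by move=> /opnorm_has_inf[? _]; apply: lb_le_inf => // x []. Qed.

Lemma opnorm_le T (r : R) :
  0 <= r -> (forall x, rnorm (T x) <= r * rnorm x) -> opnorm T <= r.
Proof. by move=> r0 rT; apply: ge_inf => //; exists 0 => x []. Qed.

Lemma rnorm_opnorm T x : bounded_linear T -> rnorm (T x) <= opnorm T * rnorm x.
Proof.
move=> bT; have hT := opnorm_has_inf bT.
apply: (@le_of_forall_inv _ _ _ (rnorm x)) => n.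
have [r [_ rT] rlt] := @inf_adherent _ _ (harmonic n) (harmonic_gt0 n) hT.
apply: le_trans (rT x) _; rewrite [rnorm x * _]mulrC -mulrDl.
by rewrite ler_wpM2r ?rnorm_ge0// ltW.
Qed.

Lemma is_adjoint_unique T S S' : is_adjoint T S -> is_adjoint T S' -> S = S'.
Proof.
move=> TS TS'; apply/funext => y; apply/eqP; rewrite -subr_eq0; apply/eqP.
by apply: ip_eq0l => x; rewrite ipBr -TS -TS' subrr.
Qed.

Lemma adjE T S : is_adjoint T S -> adj T = S.
Proof.
move=> TS; rewrite /adj; case: xgetP => [S' _ TS'|/(_ S)//].
exact: is_adjoint_unique TS' TS.
Qed.

Lemma adj_id : adj (id : H -> H) = id.
Proof. exact: adjE. Qed.

Lemma vn_adjoint M a : M a -> M (adj a) /\ is_adjoint a (adj a).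
Proof. by move=> /(vn_adj)[S MS aS]; rewrite (adjE aS). Qed.

(** The bicommutant condition in pointwise form, by which operators constructed on H are shown to
    lie in M. *)
Lemma vnP M T : M T <-> bounded_linear T /\
  forall d, commutant M d -> forall x, T (d x) = d (T x).
Proof.
rewrite -[M T]/(vn_set M T) -{1}(vn_bicommutant M); split=> -[bT Td]; split=> //.
  by move=> d /Td Tdd x; have := congr1 (@^~ x) Tdd.
by move=> d Md; apply/funext => x; exact: Td.
Qed.

Lemma vn_bounded M a : M a -> bounded_linear a. Proof. by case/vnP. Qed.

Lemma vn_linear M a : M a -> linear a. Proof. by case/vn_bounded. Qed.

Lemma vn_commute M a d x : M a -> commutant M d -> a (d x) = d (a x).
Proof. by case/vnP => _ + Md => /(_ d Md x). Qed.

Lemma commutant_bounded M d : commutant M d -> bounded_linear d.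
Proof. by case. Qed.

Lemma bounded_linear_id (V : normedModType R[i]) : bounded_linear (id : V -> V).
Proof. by split=> //; exists 1 => x; rewrite mul1r. Qed.

Lemma vn_id M : M id. Proof. by apply/vnP; split=> //; exact: bounded_linear_id. Qed.

Lemma vn_comp M a b : M a -> M b -> M (a \o b).
Proof.
move=> Ma Mb; apply/vnP; split.
  by apply: bounded_linear_comp; [exact: vn_bounded Ma|exact: vn_bounded Mb].
by move=> d Md x /=; rewrite (vn_commute _ Mb Md) (vn_commute _ Ma Md).
Qed.

Lemma vn_comb M (c : R[i]) a b : M a -> M b -> M (c *: a + b).
Proof.
move=> Ma Mb; apply/vnP; split.
  split.
    move=> k x y; rewrite /= !fctE (vn_linear Ma) (vn_linear Mb).
    by rewrite !scalerDr !scalerA [c * k]mulrC addrACA.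
  have [r r0 ra] := bounded_linear_ge0 (vn_bounded Ma).
  have [s s0 sb] := bounded_linear_ge0 (vn_bounded Mb).
  exists (normc c * r + s) => x; rewrite /= !fctE (le_trans (ler_rnormD _ _))//.
  by rewrite rnormZ mulrDl lerD// -mulrA ler_wpM2l ?normc_ge0.
move=> d Md x; have [ld _] := commutant_bounded Md.
by rewrite /= !fctE ld (vn_commute _ Ma Md) (vn_commute _ Mb Md).
Qed.

Lemma vn0 M : M 0.
Proof.
have := vn_comb (-1) (vn_id M) (vn_id M); congr (M _).
by apply/funext => x; rewrite /= !fctE scaleN1r addNr.
Qed.

Lemma commutant_adjoint M d : commutant M d ->
  exists2 d', commutant M d' & forall x y, ip (d x) y = ip x (d' y).
Proof.
move=> Md; have [d' [bd' dd']] := adjoint_exists (commutant_bounded Md).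
exists d' => //; split=> // a Ma; apply/funext => y /=.
apply: ip_ext => z; have [Ma' aa'] := vn_adjoint Ma.
rewrite ip_conj -dd' -ip_conj aa' (vn_commute _ Ma' Md).
by rewrite aa' [RHS]ip_conj -dd' -ip_conj.
Qed.

End VonNeumannAlgebras.

(** * Positivity of the form defining X (x)_M H *)

Section MatrixPositivity.
Context {R : realType} {H : hilbertType R} {M : vonNeumannAlgebra H}.
Implicit Types X : preHilbertModule M.

Lemma ip_mipC X (x y : X) h k : ip h (mip x y k) = (ip k (mip y x h))^*.
Proof. by rewrite -(mip_adj x y) ip_conj. Qed.

Lemma ip_mip_ract X (x y : X) a b h k : M a -> M b ->
  ip h (mip (ract x a) (ract y b) k) = ip (a h) (mip x y (b k)).
Proof.
move=> Ma Mb; rewrite mip_ract//= -(mip_adj y) mip_ract//= .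
by rewrite (mip_adj y).
Qed.

Lemma ip_mip_sumr X (x : X) I (r : seq I) (F : I -> X) h k :
  ip h (mip x (\sum_(i <- r) F i) k) = \sum_(i <- r) ip h (mip x (F i) k).
Proof.
rewrite (lin_sum (mip_linear x)) fct_sumE ip_sumr.
by [].
Qed.

Lemma ip_mip_suml X (x : X) I (r : seq I) (F : I -> X) h k :
  ip h (mip (\sum_(i <- r) F i) x k) = \sum_(i <- r) ip h (mip (F i) x k).
Proof.
rewrite ip_mipC ip_mip_sumr rmorph_sum.
by apply: eq_bigr => i _; rewrite /= -ip_mipC.
Qed.

(** The semi-inner product of X (x)_M H on formal sums of x (x) h. *)
Definition mform X (s t : seq (X * H)) : R[i] :=
  \sum_(p <- s) \sum_(q <- t) ip p.2 (mip p.1 q.1 q.2).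

Lemma mformC X (s t : seq (X * H)) : mform t s = (mform s t)^*.
Proof.
rewrite /mform rmorph_sum exchange_big; apply: eq_bigr => p _ /=.
by rewrite rmorph_sum; apply: eq_bigr => q _; rewrite /= -ip_mipC.
Qed.

Lemma mform_cat X (s s' t : seq (X * H)) :
  mform (s ++ s') t = mform s t + mform s' t.
Proof. exact: big_cat. Qed.

Lemma mform_perm X (s s' : seq (X * H)) :
  perm_eq s s' -> mform s s = mform s' s'.
Proof.
move=> ss'; rewrite /mform (perm_big _ ss')/=.
by apply: eq_bigr => p _; exact: perm_big.
Qed.

(** Isolates the dependence on the single vector [h], which [mform_closure_ge0] perturbs. *)
Lemma mform_cons X x h (s : seq (X * H)) :
  Re (mform ((x, h) :: s) ((x, h) :: s)) =
  rip h (mip x x h) + 2 * rip h (\sum_(q <- s) mip x q.1 q.2) + Re (mform s s).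
Proof.
have -> : (x, h) :: s = [:: (x, h)] ++ s by [].
rewrite mform_cat ReD mformC ReJ mform_cat [mform s (_ ++ _)]mformC ReJ.
rewrite mform_cat !ReD.
have -> : mform [:: (x, h)] s = ip h (\sum_(q <- s) mip x q.1 q.2).
  by rewrite /mform big_seq1 ip_sumr.
have -> : Re (mform s [:: (x, h)]) = Re (mform [:: (x, h)] s).
  by rewrite mformC ReJ.
have -> : mform [:: (x, h)] s = ip h (\sum_(q <- s) mip x q.1 q.2).
  by rewrite /mform big_seq1 ip_sumr.
by rewrite {1}/mform !big_seq1 /rip; ring.
Qed.

(** For vectors a_i k, the form collapses to <k, <x, x> k> with x the sum of the x_i a_i. *)
Lemma mform_cyclic_ge0 X (s : seq (X * (H -> H))) k :
  (forall p, p \in s -> M p.2) ->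
  0 <= Re (mform [seq (p.1, p.2 k) | p <- s] [seq (p.1, p.2 k) | p <- s]).
Proof.
move=> Ms; have := mip_ge0 (\sum_(p <- s) ract p.1 p.2) k.
rewrite ip_mip_suml.
suff -> : \sum_(p <- s) ip k (mip (ract p.1 p.2) (\sum_(q <- s) ract q.1 q.2) k)
  = mform [seq (p.1, p.2 k) | p <- s] [seq (p.1, p.2 k) | p <- s].
  by rewrite lecE => /andP[].
rewrite /mform big_map; apply: eq_big_seq => p ps.
rewrite ip_mip_sumr big_map; apply: eq_big_seq => q qs.
by rewrite ip_mip_ract /=; [|exact: Ms|exact: Ms].
Qed.

(** Limits are taken one vector at a time: the head of [s] is approximated by [a k] and moved into
    the exact list [t], where the induction hypothesis applies. *)
Lemma mform_closure_ge0 X (s : seq (X * H)) (t : seq (X * (H -> H))) k :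
  (forall p, p \in t -> M p.2) ->
  (forall p, p \in s -> forall e : R, 0 < e ->
     exists2 a, M a & rnorm (p.2 - a k) < e) ->
  let u := s ++ [seq (p.1, p.2 k) | p <- t] in 0 <= Re (mform u u).
Proof.
move=> Mt; elim: s t Mt => [|[x h] s IH] t Mt sk /=.
  exact: mform_cyclic_ge0.
set u := s ++ _; rewrite mform_cons.
set w := \sum_(q <- u) _; set A := mip x x.
have [r r0 rA] := bounded_linear_ge0 (vn_bounded (mip_in x x)).
have lA := vn_linear (mip_in x x).
(* With v the error in h, the summands bound the two cross terms of <h, A h>, the term <v, A v>
   (where |v| <= 1) and the change of the linear term. *)
pose C := 2 * r * rnorm h + r + 2 * rnorm w.
apply: (@le_of_forall_inv _ _ _ C) => n.
have [|a Ma ha] := sk (x, h) (mem_head _ _) (harmonic n).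
  exact: harmonic_gt0.
have : 0 <= Re (mform ((x, a k) :: u) ((x, a k) :: u)).
  rewrite (@mform_perm _ _ (s ++ [seq (p.1, p.2 k) | p <- (x, a) :: t])).
    apply: IH => [p|p ps]; first by rewrite inE => /predU1P[->|/Mt].
    by apply: sk; rewrite inE ps orbT.
  by rewrite perm_sym /= -cat1s perm_catCA.
rewrite mform_cons -/w -/A.
set v := h - a k in ha *.
have -> : a k = h - v by rewrite /v opprB addrC subrK.
have vn0 : 0 <= rnorm v by exact: rnorm_ge0.
have h0 : 0 <= rnorm h by exact: rnorm_ge0.
have w0 : 0 <= rnorm w by exact: rnorm_ge0.
rewrite -/A in rA lA.
have -> : rip (h - v) (A (h - v)) =
    rip h (A h) - rip h (A v) - rip v (A h) + rip v (A v).
  by rewrite (linB lA) !(ripDl, ripDr, ripNl, ripNr); ring.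
have -> : rip (h - v) w = rip h w - rip v w by rewrite ripDl ripNl.
have e1 : - rip h (A v) <= r * rnorm h * rnorm v.
  rewrite -ripNr; apply: le_trans (rip_le _ _) _; rewrite rnormN.
  by rewrite [r * _]mulrC -mulrA ler_wpM2l.
have e2 : - rip v (A h) <= r * rnorm h * rnorm v.
  rewrite -ripNr; apply: le_trans (rip_le _ _) _; rewrite rnormN.
  by rewrite mulrC ler_wpM2r.
have e3 : rip v (A v) <= r * rnorm v.
  apply: le_trans (rip_le _ _) _; rewrite mulrC -[leRHS]mulr1.
  apply: ler_pM; rewrite ?rnorm_ge0//.
  apply: ltW (lt_le_trans ha _); rewrite invf_le1 ?ler1n//.
have e4 : - rip v w <= rnorm v * rnorm w.
  rewrite -ripNr; apply: le_trans (rip_le _ _) _; by rewrite rnormN.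
have e5 : C * rnorm v <= C * harmonic n.
  rewrite ler_wpM2l ?(ltW ha)// /C.
  by rewrite !addr_ge0// !mulr_ge0.
rewrite /C in e5 *; lra.
Qed.

(* Split all vectors along the closure of M k, k being the first of them: the parts
   inside are limits of the cyclic case, while outside k contributes 0, so that the
   number of vectors drops. *)
Theorem mform_ge0 X (s : seq (X * H)) : 0 <= mform s s.
Proof.
have im0 : Im (mform s s) = 0.
  have := congr1 (@complex.Im R) (mformC s s); rewrite ImJ; lra.
rewrite lecE im0 eqxx /=.
move: {2}(size s) (leqnn (size s)) => {im0} n; elim: n s => [|n IH] s.
  by rewrite leqn0 size_eq0 => /eqP->; rewrite /mform big_nil.
case: s => [|[x k] s] sn; first by rewrite /mform big_nil.
pose T (a : {a | M a}) := sval a k.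
have /choice[P PP] : forall v : H, exists p : H,
    (forall a, M a -> ip p (a k) = ip v (a k)) /\ in_span T p.
  move=> v.
  have [||p [pP pT _]] := @riesz R _ H T (fun i => ip v (T i)) (rnorm v).
  - exact: rnorm_ge0.
  - by move=> t; rewrite -(ip_lcombr v T); exact: normc_ip_le.
  - by exists p; split=> // a Ma; exact: (pP (exist _ a Ma)).
have PMk v (e : R) : 0 < e -> exists2 a, M a & rnorm (P v - a k) < e.
  move=> /(PP v).2[t Pt]; exists (\sum_(p <- t) p.1 *: sval p.2).
    elim: (t) => [|p t' IHt]; first by rewrite big_nil; exact: vn0.
    by rewrite big_cons; apply: vn_comb IHt; exact: svalP.
  by rewrite fct_sumE; exact: Pt.
(* The closure of M k is invariant under M, hence so is its orthogonal complement, M being closed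
   under adjoints. *)
have PA A v v' : M A -> ip (A (v' - P v')) (P v) = 0.
  move=> MA; apply: (in_span_orthogonal (PP v).2) => -[a Ma]; rewrite /T /=.
  have [MA' AA'] := vn_adjoint MA.
  by rewrite AA' ipBl -[adj A (a k)]/((adj A \o a) k) (PP v').1 ?subrr//; exact: vn_comp.
have Pk : k - P k = 0.
  have := PA id k k (vn_id M); rewrite ipBl => h.
  apply: rnorm_eq0; apply/eqP; rewrite -sqrf_eq0 -ripxx /rip ipBr.
  rewrite ipBl (PP k).1 ?subrr ?sub0r; last exact: vn_id.
  by rewrite (PA id _ _ (vn_id M)) oppr0.
pose u := (x, k) :: s.
pose sP := [seq (p.1, P p.2) | p <- u]; pose sN := [seq (p.1, p.2 - P p.2) | p <- u].
have -> : mform u u = mform sP sP + mform sN sN.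
  rewrite /mform !big_map -big_split; apply: eq_bigr => p _ /=.
  rewrite !big_map -big_split; apply: eq_bigr => q _ /=.
  have [] := (mip_in p.1 q.1, mip_in q.1 p.1) => m1 m2.
  have PNA v v' : ip (v - P v) (mip p.1 q.1 (P v')) = 0.
    by rewrite -(mip_adj q.1 p.1) PA.
  have NPA v v' : ip (P v) (mip p.1 q.1 (v' - P v')) = 0.
    by rewrite ip_conj PA// rmorph0.
  transitivity (ip (P p.2 + (p.2 - P p.2)) (mip p.1 q.1 (P q.2 + (q.2 - P q.2)))).
    by rewrite ![P _ + _]addrC !subrK.
  by rewrite (linD (vn_linear m1)) ipDl !ipDr PNA NPA addr0 add0r.
rewrite ReD addr_ge0//.
  have := @mform_closure_ge0 X sP [::] k; rewrite cats0; apply=> //.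
  by move=> p /mapP[q _ ->] e e0 /=; exact: PMk.
rewrite /sN /= Pk mform_cons.
rewrite (lin0 (vn_linear (mip_in x x))) rip0r ripC rip0r mulr0 !add0r.
by apply: IH; rewrite size_map.
Qed.

End MatrixPositivity.

(** * Kolmogorov decomposition *)

Lemma complex_cauchy_cvg (R : realType) (z : nat -> R[i]) :
  (forall e : R, 0 < e -> exists N, forall m n, (N <= m)%N -> (N <= n)%N ->
    normc (z m - z n) < e) ->
  exists l, forall e : R, 0 < e -> exists N, forall n, (N <= n)%N ->
    normc (z n - l) < e.
Proof.
move=> cz.
have key (f : R[i] -> R) : (forall z w, `|f z - f w| <= normc (z - w)) ->
    exists l : R, forall e : R, 0 < e -> exists N, forall n, (N <= n)%N ->
    `|f (z n) - l| < e.
  move=> fz; have : cvg ((f \o z) @ \oo).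
    apply: cauchy_cvg; apply: cauchy_exP => e e0.
    have [N HN] := cz e e0; exists (f (z N)); exists N => // n /= Nn.
    by rewrite -ball_normE /ball_/= (le_lt_trans (fz _ _))// HN.
  move=> /cvg_ex[l /cvgrPdist_lt ul]; exists l => e /ul[N _ HN].
  by exists N => n Nn; rewrite distrC; exact: HN.
have [|a za] := key (@complex.Re R).
  by move=> u v; rewrite -ReB le_Re_normc.
have [|b zb] := key (@complex.Im R).
  by move=> u v; rewrite -ImN -ImD le_Im_normc.
exists (a +i* b) => e e0.
have e2 : 0 < e / 2 by rewrite divr_gt0.
have [N HN] := za _ e2; have [N' HN'] := zb _ e2.
exists (maxn N N') => n; rewrite geq_max => /andP[Nn Nn'].
apply: le_lt_trans (normc_le_ReIm _) _; rewrite ReB ImD ImN /=.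
by rewrite [e]splitr ltrD ?HN ?HN'.
Qed.

Lemma discriminant_le (R : realType) (a b c : R) : 0 <= a -> 0 <= c ->
  (forall r, 0 <= a + 2 * r * b + r ^+ 2 * c) -> b <= Num.sqrt a * Num.sqrt c.
Proof.
move=> a0 c0 h; rewrite -sqrtrM//; apply: le_trans (ler_norm b) _.
rewrite -sqrtr_sqr ler_wsqrtr//.
have [cE|cn0] := eqVneq c 0.
  have [->|bn0] := eqVneq b 0; first by rewrite expr0n mulr_ge0.
  (* For c = 0 the polynomial is affine, and it would take the value -1 at this point. *)
  have := h (- (a + 1) / (2 * b)); rewrite cE mulr0 addr0.
  have -> : a + 2 * (- (a + 1) / (2 * b)) * b = -1 by field.
  lra.
have cp : 0 < c by rewrite lt_neqAle eq_sym cn0.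
have := h (- b / c).
have -> : a + 2 * (- b / c) * b + (- b / c) ^+ 2 * c = (a * c - b ^+ 2) / c by field.
by rewrite pmulr_lge0 ?invr_gt0// subr_ge0.
Qed.

Record posdef_kernel (R : realType) (I : Type) := PosdefKernel {
  pdk :> I -> I -> R[i];
  pdkC : forall i j, pdk j i = (pdk i j)^*;
  pdk_ge0 : forall s : seq (R[i] * I),
    0 <= \sum_(p <- s) \sum_(q <- s) p.1^* * (q.1 * pdk p.2 q.2)
}.

(* Moore-Aronszajn: a vector v is encoded by the function i |-> <tau_i, v>. *)
Section ReproducingKernel.
Context {R : realType} {I : Type} (k : posdef_kernel R I).
Implicit Types (s t : seq (R[i] * I)) (f g : I -> R[i]^o).

(** If [f] encodes the vector v, this is the inner product of the formal sum [s] with v; the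
    conjugates come from the antilinear slot. Likewise [krep s] encodes [s] itself, and [kform] is
    the inner product of two formal sums. *)
Definition kev f s : R[i] := \sum_(p <- s) p.1^* * f p.2.
Definition krep s : I -> R[i]^o := fun i => \sum_(p <- s) p.1 * k i p.2.
Definition kform s t : R[i] := kev (krep t) s.

Lemma kev_cat f s t : kev f (s ++ t) = kev f s + kev f t.
Proof. exact: big_cat. Qed.

Lemma kev_scale f a s : kev f (cscale a s) = a^* * kev f s.
Proof.
rewrite /kev big_map mulr_sumr; apply: eq_bigr => p _.
by rewrite rmorphM mulrA.
Qed.

Lemma kev_comb a f g s : kev (a *: f + g) s = a * kev f s + kev g s.
Proof.
rewrite /kev mulr_sumr -big_split; apply: eq_bigr => p _ /=.
by rewrite !fctE /= mulrDr mulrCA.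
Qed.

Lemma krep_cat s t : krep (s ++ t) = krep s + krep t.
Proof. by apply/funext => i; exact: big_cat. Qed.

Lemma krep_scale a s : krep (cscale a s) = a *: krep s.
Proof.
apply/funext => i; rewrite /krep !fctE big_map /= scaler_sumr.
by apply: eq_bigr => p _; rewrite -mulrA.
Qed.

Lemma kformC s t : kform t s = (kform s t)^*.
Proof.
rewrite /kform /kev /krep rmorph_sum.
under eq_bigr do rewrite mulr_sumr.
rewrite exchange_big; apply: eq_bigr => p _ /=.
rewrite mulr_sumr rmorph_sum; apply: eq_bigr => q _ /=.
by rewrite !rmorphM /= -pdkC conjc_conjc mulrCA.
Qed.

Lemma kform_ge0 s : 0 <= kform s s.
Proof.
have := pdk_ge0 k s; congr (0 <= _); apply: eq_bigr => p _.
by rewrite mulr_sumr.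
Qed.

Definition ksqr s : R := Re (kform s s).
Definition knrm s : R := Num.sqrt (ksqr s).

Lemma ksqr_ge0 s : 0 <= ksqr s.
Proof. by have := kform_ge0 s; rewrite lecE => /andP[]. Qed.

Lemma kformE s : kform s s = (knrm s ^+ 2)%:C.
Proof. by rewrite sqr_sqrtr ?ksqr_ge0// -ge0_complexE// kform_ge0. Qed.

Lemma knrm_ge0 s : 0 <= knrm s. Proof. exact: sqrtr_ge0. Qed.

Lemma ksqr_comb (r : R) s t :
  ksqr (s ++ cscale r%:C t) = ksqr s + 2 * r * Re (kform s t) + r ^+ 2 * ksqr t.
Proof.
rewrite /ksqr /kform krep_cat krep_scale (addrC (krep s)) kev_cat kev_scale.
rewrite !kev_comb conjc_realE.
rewrite -/(kform s s) -/(kform t t) -/(kform s t) -/(kform t s) (kformC s t).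
rewrite !(ReD, ReZ, ReJ); ring.
Qed.

Lemma Re_kform_le s t : Re (kform s t) <= knrm s * knrm t.
Proof.
apply: discriminant_le => [||r]; rewrite ?ksqr_ge0//.
by rewrite -ksqr_comb ksqr_ge0.
Qed.

Lemma normc_kform_le s t : normc (kform s t) <= knrm s * knrm t.
Proof.
set z := kform s t; have [->|z0] := eqVneq (normc z) 0.
  by rewrite mulr_ge0 ?knrm_ge0.
have zp : 0 < normc z by rewrite lt_neqAle eq_sym z0 normc_ge0.
rewrite -(ler_pM2l zp) -expr2.
have -> : normc z ^+ 2 = Re (kform (cscale z s) t).
  by rewrite /kform kev_scale normc_sqrE.
apply: le_trans (Re_kform_le _ _) _.
suff -> : knrm (cscale z s) = normc z * knrm s by rewrite mulrA.
rewrite /knrm /ksqr /kform krep_scale kev_scale.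
have := kev_comb z (krep s) 0 s; rewrite addr0 => ->.
have -> : kev 0 s = 0 by rewrite /kev big1// => p _; exact: mulr0.
rewrite addr0 mulrA normc_sqrE ReZ sqrtrM ?sqr_ge0// sqrtr_sqr.
by rewrite ger0_norm ?normc_ge0.
Qed.

(** The norm of a vector is measured by duality against formal sums, before an inner product on
    functions exists. *)
Definition kbound f (r : R) : Prop :=
  0 <= r /\ forall s, normc (kev f s) <= r * knrm s.

Lemma kbound_comb a f g r r' : kbound f r -> kbound g r' ->
  kbound (a *: f + g) (normc a * r + r').
Proof.
move=> [r0 fr] [r'0 gr]; split.
  by rewrite addr_ge0// mulr_ge0// normc_ge0.
move=> s; rewrite kev_comb (le_trans (le_normcD _ _))// normcM mulrDl.
by rewrite lerD// -mulrA ler_wpM2l ?normc_ge0.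
Qed.

Lemma kbound0 : kbound 0 0.
Proof.
split=> // s; rewrite /kev big1 ?normc0 ?mul0r// => p _.
exact: mulr0.
Qed.

Lemma kboundZ a f r : kbound f r -> kbound (a *: f) (normc a * r).
Proof. by move=> fr; have := kbound_comb a fr kbound0; rewrite !addr0. Qed.

Lemma normcN1 : normc (-1 : R[i]) = 1.
Proof. by rewrite normcN normc1. Qed.

Lemma kboundB f g r r' : kbound f r -> kbound g r' -> kbound (f - g) (r + r').
Proof.
move=> fr gr; have := kbound_comb (-1) gr fr.
by rewrite normcN1 mul1r scaleN1r addrC [r' + _]addrC.
Qed.

Lemma kboundD f g r r' : kbound f r -> kbound g r' -> kbound (f + g) (r + r').
Proof.
by move=> fr gr; have := kbound_comb 1 fr gr; rewrite normc1 mul1r scale1r.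
Qed.

Lemma kbound_le f r r' : r <= r' -> kbound f r -> kbound f r'.
Proof.
move=> rr [r0 fr]; split; first exact: le_trans rr.
by move=> s; apply: le_trans (fr s) _; rewrite ler_wpM2r ?knrm_ge0.
Qed.

Lemma kbound_krep s : kbound (krep s) (knrm s).
Proof.
split=> [|t]; first exact: knrm_ge0.
by rewrite mulrC; exact: normc_kform_le.
Qed.

Lemma knrm_le s r : kbound (krep s) r -> knrm s <= r.
Proof.
move=> [r0 /(_ s)]; rewrite -/(kform s s) kformE normc_real ger0_norm ?sqr_ge0//.
have [->//|sn0] := eqVneq (knrm s) 0.
by rewrite expr2 ler_pM2r// lt_neqAle eq_sym sn0 knrm_ge0.
Qed.

(** The completion is taken inside the functions on [I], as the closure of the formal sums in the
    dual norm. Null vectors already give the zero function there. *)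
Definition kclosure : {pred (I -> R[i]^o)} :=
  mem [set f | forall e : R, 0 < e -> exists s, kbound (f - krep s) e].

Lemma kclosureP f : reflect
  (forall e : R, 0 < e -> exists s, kbound (f - krep s) e) (f \in kclosure).
Proof. by apply: (iffP idP) => [/set_mem|?]; last exact/mem_set. Qed.

Lemma kclosure_submod : submod_closed kclosure.
Proof.
split.
  apply/kclosureP => e e0; exists [::].
  have -> : krep [::] = 0 by apply/funext => i; rewrite /krep big_nil.
  by rewrite subr0; apply: kbound_le kbound0; exact: ltW.
move=> a f g /kclosureP fc /kclosureP gc; apply/kclosureP => e e0.
have a1 : 0 < normc a + 1 by rewrite ltr_wpDl ?normc_ge0.
have [|s fs] := fc (e / 2 / (normc a + 1)); first by rewrite !divr_gt0.
have [|t gt] := gc (e / 2); first by rewrite divr_gt0.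
exists (cscale a s ++ t); rewrite krep_cat krep_scale.
have -> : a *: f + g - (a *: krep s + krep t) = a *: (f - krep s) + (g - krep t).
  by rewrite scalerBr opprD addrACA.
apply: kbound_le (kbound_comb a fs gt).
rewrite [leRHS]splitr lerD2r mulrA ler_pdivrMr// mulrC.
by rewrite ler_wpM2l ?lerDl// divr_ge0// ltW.
Qed.

HB.instance Definition _ :=
  GRing.isSubmodClosed.Build R[i] (I -> R[i]^o) kclosure kclosure_submod.

Record kspace := KSpace { kfun :> I -> R[i]^o; kfunP : kfun \in kclosure }.

HB.instance Definition _ := [isSub for kfun].
HB.instance Definition _ := [Choice of kspace by <:].
HB.instance Definition _ := [SubChoice_isSubLmodule of kspace by <:].

Implicit Types x y z : kspace.

Lemma kfunE a x y : kfun (a *: x + y) = a *: kfun x + kfun y. Proof. by []. Qed.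

Lemma kspace_approx x (e : R) : 0 < e -> exists s, kbound (kfun x - krep s) e.
Proof. by have /kclosureP := kfunP x => + e0 => /(_ e e0). Qed.

Definition knorm x : R := inf [set r | kbound x r].

Lemma kbound_has_inf x : has_inf [set r | kbound x r].
Proof.
split; last by exists 0 => r [].
have [s xs] := kspace_approx x ltr01; exists (1 + knrm s) => /=.
by have := kboundD xs (kbound_krep s); rewrite subrK.
Qed.

Lemma knorm_ge0 x : 0 <= knorm x.
Proof. by apply: lb_le_inf => [|r []//]; case: (kbound_has_inf x). Qed.

Lemma knorm_le x r : kbound x r -> knorm x <= r.
Proof. by move=> xr; apply: ge_inf => //; exists 0 => ? []. Qed.

Lemma kbound_knorm x : kbound x (knorm x).
Proof.
split=> [|s]; first exact: knorm_ge0.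
apply: (@le_of_forall_inv _ _ _ (knrm s)) => n.
have [r [_ rx] rlt] := @inf_adherent _ _ (harmonic n) (harmonic_gt0 n) (kbound_has_inf x).
apply: le_trans (rx s) _; rewrite [knrm s * _]mulrC -mulrDl.
by rewrite ler_wpM2r ?knrm_ge0// ltW.
Qed.

Lemma knormD x y : knorm (x + y) <= knorm x + knorm y.
Proof. by apply: knorm_le; exact: (kboundD (kbound_knorm x) (kbound_knorm y)). Qed.

Lemma knormZ_le a x : knorm (a *: x) <= normc a * knorm x.
Proof. by apply: knorm_le; exact: (kboundZ a (kbound_knorm x)). Qed.

Lemma knormZ a x : knorm (a *: x) = normc a * knorm x.
Proof.
apply/eqP; rewrite eq_le knormZ_le /=.
have [->|a0] := eqVneq a 0; first by rewrite normc0 mul0r knorm_ge0.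
have na : 0 < normc a.
  rewrite lt_neqAle normc_ge0 andbT eq_sym.
  by apply/contra_neq: a0; exact: eq0_normc.
rewrite -{1}[x]scale1r -(mulVf a0) -scalerA.
apply: le_trans (_ : normc a * (normc a^-1 * knorm (a *: x)) <= _).
  by rewrite ler_pM2l// knormZ_le.
by rewrite mulrA normcV mulfV ?mul1r ?gt_eqF.
Qed.

Lemma knormN x : knorm (- x) = knorm x.
Proof. by rewrite -scaleN1r knormZ normcN1 mul1r. Qed.

Lemma knorm_eq0 x : knorm x = 0 -> x = 0.
Proof.
move=> x0; apply/val_inj/funext => i; have [_] := kbound_knorm x.
move=> /(_ [:: (1, i)]); rewrite x0 mul0r /kev big_seq1 /= => h.
have /eqP : normc ((1 : R[i])^* * kfun x i) == 0 by rewrite eq_le h normc_ge0.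
by move=> /eq0_normc; rewrite rmorph1 mul1r.
Qed.

Fact kspace_normD x y : (knorm (x + y))%:C <= (knorm x)%:C + (knorm y)%:C :> R[i].
Proof. by rewrite -rmorphD lecR knormD. Qed.

Fact kspace_normZ (a : R[i]) x : (knorm (a *: x))%:C = `|a| * (knorm x)%:C.
Proof. by rewrite knormZ rmorphM. Qed.

Fact kspace_norm0 x : (knorm x)%:C = 0 :> R[i] -> x = 0.
Proof. by move=> /complexI/knorm_eq0. Qed.

HB.instance Definition _ := @Lmodule_isNormed.Build R[i] kspace
  (fun x => (knorm x)%:C) kspace_normD kspace_normZ kspace_norm0.

Lemma rnorm_kspace x : rnorm x = knorm x. Proof. by []. Qed.

Lemma kspace_complete (F : set_system kspace) : ProperFilter F -> cauchy F -> cvg F.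
Proof.
move=> FF /cauchyP cF.
(* A Cauchy filter contains balls of arbitrarily small radius; their centres form a Cauchy
   sequence. *)
have /choice[u uP] : forall n : nat, exists x : kspace, F (ball x (harmonic n)%:C).
  by move=> n; apply: cF; rewrite ltcR harmonic_gt0.
have ballE x y (e : R) : ball x e%:C y -> kbound (x - y) e.
  rewrite -ball_normE /ball_/= rnormE rnorm_kspace ltcR => /ltW xy.
  exact: kbound_le xy (kbound_knorm (x - y)).
have uu m n : kbound (u m - u n) (harmonic m + harmonic n).
  have [x [/ballE xm /ballE xn]] := filter_ex (filterI (uP m) (uP n)).
  have := kboundB xm xn; rewrite opprB addrA subrK.
  by [].
(* Evaluation at [i] is the pairing with the formal sum of the single term [(1, i)], so the centres
   converge pointwise. *)
have /choice[g gP] : forall i, exists l, forall e : R, 0 < e ->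
    exists N, forall n, (N <= n)%N -> normc (kfun (u n) i - l) < e.
  move=> i; apply: complex_cauchy_cvg => e e0.
  have k1 : 0 < knrm [:: (1, i)] + 1 by rewrite ltr_wpDl ?knrm_ge0.
  have [N HN] := archi_inv (divr_gt0 (divr_gt0 e0 (ltr0n R 2)) k1).
  exists N => m n Nm Nn; have [_ /(_ [:: (1, i)])] := uu m n.
  rewrite /kev big_seq1 /= rmorph1 mul1r => h; apply: le_lt_trans h _.
  have := HN _ Nm; have := HN _ Nn; rewrite !ltr_pdivlMr//.
  have := harmonic_gt0 m : 0 < harmonic m :> R.
  have := harmonic_gt0 n : 0 < harmonic n :> R.
  rewrite -[2%:R]/2; move: (knrm _) k1 (harmonic m) (harmonic n) => K K1 hm hn; lra.
have gs s : forall e : R, 0 < e -> exists N, forall n, (N <= n)%N ->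
    normc (kev (u n) s - kev g s) < e.
  elim: s => [|[a i] s IH] e e0.
    by exists 0%N => n _; rewrite /kev !big_nil subrr normc0.
  have a1 : 0 < normc a + 1 by rewrite ltr_wpDl ?normc_ge0.
  have e2 : 0 < e / 2 by rewrite divr_gt0.
  have [N HN] := IH _ e2; have [N' HN'] := gP i _ (divr_gt0 e2 a1).
  exists (maxn N N') => n; rewrite geq_max => /andP[Nn Nn'].
  rewrite /kev !big_cons /= opprD addrACA -mulrBr [e]splitr.
  apply: le_lt_trans (le_normcD _ _) _; apply: ler_ltD; last exact: HN.
  rewrite normcM normcJ; have := HN' _ Nn'; rewrite ltr_pdivlMr//.
  have := normc_ge0 (kfun (u n) i - g i); lra.
have gu n : kbound (kfun (u n) - g) (2 * harmonic n).
  split=> [|s]; first by rewrite mulr_ge0 ?harmonic_ge0.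
  apply: (@le_of_forall_inv _ _ _ (knrm s + 1)) => m.
  have [N HN] := gs s _ (harmonic_gt0 m).
  have [_ /(_ s)] := uu n (maxn (maxn N m) n).
  set j := maxn _ _.
  have Nj : (N <= j)%N by rewrite /j !leq_max leqnn.
  have mj : (m <= j)%N by rewrite /j !leq_max leqnn orbT.
  have nj : (n <= j)%N by rewrite /j !leq_max leqnn orbT.
  have hjm : harmonic j <= harmonic m :> R by rewrite lef_pV2 ?posrE// ler_nat.
  have hjn : harmonic j <= harmonic n :> R by rewrite lef_pV2 ?posrE// ler_nat.
  move: (HN j Nj) => gj unj.
  have kevB f f' : kev (f - f') s = kev f s - kev f' s.
    by rewrite addrC -scaleN1r kev_comb mulN1r addrC.
  rewrite kevB -[kev (u n) s](subrK (kev (u j) s)) -addrA.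
  apply: le_trans (le_normcD _ _) _; rewrite -kevB.
  have : (harmonic n + harmonic j) * knrm s <= 2 * harmonic n * knrm s.
    by rewrite ler_wpM2r ?knrm_ge0// mulr_natl mulr2n lerD2l.
  have : 0 <= knrm s * harmonic m by rewrite mulr_ge0 ?knrm_ge0 ?harmonic_ge0.
  lra.
have gK : g \in kclosure.
  apply/kclosureP => e e0; have e3 : 0 < e / 3 by rewrite divr_gt0.
  have [N /(_ N (leqnn N)) HN] := archi_inv e3.
  have [s us] := kspace_approx (u N) (harmonic_gt0 N); exists s.
  have := kboundB us (gu N).
  have -> : kfun (u N) - krep s - (kfun (u N) - g) = g - krep s.
    by rewrite opprB addrC addrA subrK.
  by apply: kbound_le; lra.
apply/cvg_ex; exists (KSpace gK).
move=> A /nbhs_ballP[e' /= /gt0_complexP[e e0 ->] eA].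
have [|N /(_ N (leqnn N)) HN] := @archi_inv _ (e / 3); first by rewrite divr_gt0.
apply: filterS (uP N) => x; rewrite -!ball_normE /ball_/= rnormE rnorm_kspace ltcR.
move=> ux; apply: eA; rewrite -ball_normE /ball_/= rnormE rnorm_kspace ltcR.
have -> : KSpace gK - x = (u N - x) - (u N - KSpace gK).
  by rewrite opprB [RHS]addrC addrA subrK.
apply: le_lt_trans (knormD _ _) _.
have : knorm (u N - KSpace gK) <= 2 * harmonic N by exact/knorm_le/gu.
rewrite knormN; lra.
Qed.

HB.instance Definition _ := Uniform_isComplete.Build kspace kspace_complete.

(** The inner product is the limit of [kev y s] as [krep s] tends to x. Recording the error makes
    one [l] serve for every approximation. *)
Lemma kip_exists x y : exists l, forall s (d : R), kbound (kfun x - krep s) d ->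
  normc (kev y s - l) <= d * knorm y.
Proof.
have /choice[u uP] : forall n : nat, exists s, kbound (kfun x - krep s) (harmonic n).
  by move=> n; apply/kspace_approx/harmonic_gt0.
have kevB f s t : kev f s - kev f t = kev f (s ++ cscale (-1) t).
  by rewrite kev_cat kev_scale rmorphN rmorph1 mulN1r.
have diff s t d d' : kbound (kfun x - krep s) d -> kbound (kfun x - krep t) d' ->
    normc (kev y s - kev y t) <= knorm y * (d + d').
  move=> xs xt; rewrite kevB; have [_ h] := kbound_knorm y.
  apply: le_trans (h _) _; rewrite ler_wpM2l ?knorm_ge0//; apply: knrm_le.
  rewrite krep_cat krep_scale scaleN1r.
  have := kboundB xt xs; rewrite [d' + d]addrC; congr kbound.
  by rewrite opprB addrC addrA subrK.
have y1 : 0 < knorm y + 1 by rewrite ltr_wpDl ?knorm_ge0.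
have [l lP] : exists l, forall e : R, 0 < e -> exists N, forall n, (N <= n)%N ->
    normc (kev y (u n) - l) < e.
  apply: complex_cauchy_cvg => e e0.
  have [N HN] := archi_inv (divr_gt0 (divr_gt0 e0 (ltr0n R 2)) y1).
  exists N => m n Nm Nn; apply: le_lt_trans (diff _ _ _ _ (uP m) (uP n)) _.
  have := HN _ Nm; have := HN _ Nn; rewrite !ltr_pdivlMr//.
  have := harmonic_gt0 m : 0 < harmonic m :> R.
  have := harmonic_gt0 n : 0 < harmonic n :> R.
  rewrite -[2%:R]/2; move: (knorm _) y1 (harmonic m) (harmonic n) => K K1 hm hn; lra.
exists l => s d xs; apply: (@le_of_forall_inv _ _ _ (knorm y + 1)) => n.
have [N HN] := lP _ (harmonic_gt0 n).
have Nj : (N <= maxn N n)%N by rewrite leq_maxl.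
have nj : (n <= maxn N n)%N by rewrite leq_maxr.
move: (maxn N n) Nj nj => j Nj nj.
have hj : harmonic j <= harmonic n :> R by rewrite lef_pV2 ?posrE// ler_nat.
rewrite -[kev y s](subrK (kev y (u j))) -addrA.
apply: le_trans (le_normcD _ _) _.
have := diff _ _ _ _ xs (uP j); have := HN j Nj.
have : knorm y * harmonic j <= knorm y * harmonic n by rewrite ler_wpM2l ?knorm_ge0.
lra.
Qed.

Definition kip x y : R[i] := sval (cid (kip_exists x y)).

Lemma kipP x y s (d : R) : kbound (kfun x - krep s) d ->
  normc (kev y s - kip x y) <= d * knorm y.
Proof. exact: (svalP (cid (kip_exists x y))). Qed.

(** Restricting to d <= 1 allows errors of order d^2 to be absorbed into [d * C]. *)
Lemma kip_unique x y l (C : R) : (forall s (d : R), 0 < d -> d <= 1 ->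
    kbound (kfun x - krep s) d -> normc (kev y s - l) <= d * C) -> kip x y = l.
Proof.
move=> lP; apply/eqP; rewrite -subr_eq0; apply/eqP/eq0_normc/eqP.
rewrite eq_le normc_ge0 andbT.
apply: (@le_of_forall_inv _ _ _ (C + knorm y)) => n.
have [s xs] := kspace_approx x (harmonic_gt0 n).
have n1 : harmonic n <= 1 :> R by rewrite invf_le1 ?ler1n.
have := lP s _ (harmonic_gt0 n) n1 xs; have := kipP y xs.
rewrite normcB => h1 h2; rewrite -[kip x y](subrK (kev y s)) -addrA.
apply: le_trans (le_normcD _ _) _; lra.
Qed.

Fact kip_linear x (c : R[i]) y z : kip x (c *: y + z) = c * kip x y + kip x z.
Proof.
apply: (@kip_unique _ _ _ (normc c * knorm y + knorm z)) => s d d0 _ xs.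
rewrite kfunE kev_comb opprD addrACA -mulrBr.
apply: le_trans (le_normcD _ _) _; rewrite normcM mulrDr; apply: lerD.
  by rewrite mulrCA ler_wpM2l ?normc_ge0//; exact: kipP.
exact: kipP.
Qed.

Lemma knrm_approx x s (d : R) : kbound (kfun x - krep s) d ->
  knrm s <= knorm x + d /\ knorm x <= knrm s + d.
Proof.
move=> xs; split.
  apply: knrm_le; have := kboundB (kbound_knorm x) xs.
  by rewrite opprB addrC subrK.
apply: knorm_le; have := kboundD xs (kbound_krep s).
by rewrite subrK addrC.
Qed.

Lemma kev_approx x s t (d : R) : kbound (kfun x - krep s) d ->
  normc (kev x t - kform t s) <= d * knrm t.
Proof.
move=> [_ /(_ t)]; congr (normc _ <= _).
by rewrite addrC -scaleN1r kev_comb mulN1r addrC.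
Qed.

Fact kip_conj x y : kip y x = (kip x y)^*.
Proof.
apply: (@kip_unique _ _ _ (2 * knorm x + 2 * knorm y + 2)) => t d d0 d1 yt.
have [s xs] := kspace_approx x d0.
have [tn _] := knrm_approx yt; have [sn _] := knrm_approx xs.
have h1 := kev_approx t xs.
have h2 : normc ((kev y s)^* - kform t s) <= d * knrm s.
  by rewrite kformC -rmorphB normcJ; exact: kev_approx.
have h3 : normc ((kev y s)^* - (kip x y)^*) <= d * knorm y.
  by rewrite -rmorphB normcJ; exact: kipP.
rewrite -[kev x t](subrK (kform t s)) -addrA.
apply: le_trans (le_normcD _ _) _.
rewrite -{2}[kform t s](subrK (kev y s)^*) -[X in normc _ + normc X]addrA.
have := le_normcD (kform t s - (kev y s)^*) ((kev y s)^* - (kip x y)^*).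
rewrite [normc (kform t s - _)]normcB => h4.
have h5 : d * knrm t <= d * (knorm y + d) by rewrite ler_pM2l.
have h6 : d * knrm s <= d * (knorm x + d) by rewrite ler_pM2l.
have h7 : d * d <= d * 1 by rewrite ler_pM2l.
have h8 : 0 <= d * knorm x by rewrite mulr_ge0 ?knorm_ge0// ltW.
lra.
Qed.

Fact kip_norm x : `|x| ^+ 2 = kip x x.
Proof.
apply/esym; rewrite rnormE rnorm_kspace -rmorphXn.
apply: (@kip_unique _ _ _ (3 * knorm x + 2)) => s d d0 d1 xs.
have h1 := kev_approx s xs; rewrite kformE in h1.
have [n1 n2] := knrm_approx xs.
rewrite -[kev x s](subrK (knrm s ^+ 2)%:C) -addrA -rmorphB.
apply: le_trans (le_normcD _ _) _; rewrite normc_real.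
have x0 := knorm_ge0 x; have s0 := knrm_ge0 s.
have h2 : d * knrm s <= d * (knorm x + d) by rewrite ler_pM2l.
have h3 : d * d <= d * 1 by rewrite ler_pM2l.
have : `|knrm s ^+ 2 - knorm x ^+ 2| <= d * (2 * knorm x + 1).
  rewrite subr_sqr normrM ler_pM// ?normr_ge0//.
    by rewrite ler_norml; apply/andP; split; lra.
  by rewrite ger0_norm ?addr_ge0//; lra.
lra.
Qed.

HB.instance Definition _ :=
  NormedModule_isHilbert.Build R kspace kip_linear kip_conj kip_norm.

End ReproducingKernel.

Theorem kolmogorov (R : realType) (I : Type) (k : I -> I -> R[i]) :
  (forall i j, k j i = (k i j)^*) ->
  (forall s : seq (R[i] * I),
    0 <= \sum_(p <- s) \sum_(q <- s) p.1^* * (q.1 * k p.2 q.2)) ->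
  exists (K : hilbertType R) (T : I -> K),
    total T /\ forall i j, ip (T i) (T j) = k i j.
Proof.
move=> kC k0; pose K := PosdefKernel kC k0.
have TK i : krep K [:: (1, i)] \in kclosure K.
  apply/kclosureP => e e0; exists [:: (1, i)]; rewrite subrr.
  by apply: kbound_le (kbound0 K); exact: ltW.
pose T i : kspace K := KSpace (TK i).
have ipT i (x : kspace K) : ip (T i) x = x i.
  (* The approximation is exact, and error 0 in [kipP] yields the reproducing property. *)
  have Ti : kbound K (kfun (T i) - krep K [:: (1, i)]) 0.
    by rewrite subrr; exact: kbound0.
  have := kipP x Ti; rewrite mul0r => h.
  have /eqP/eq0_normc/eqP : normc (kev x [:: (1, i)] - kip (T i) x) == 0.
    by rewrite eq_le h normc_ge0.
  by rewrite subr_eq0 /kev big_seq1 rmorph1 mul1r => /eqP.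
exists (kspace K), T; split=> [x xT|i j].
  apply/val_inj/funext => i /=; rewrite -(ipT i) ip_conj xT.
  by rewrite rmorph0.
by rewrite ipT /= /krep big_seq1 mul1r.
Qed.

(** * Hilbert modules as spaces of operators *)

Section Projection.
Context {R : realType} {I : Type} {K : hilbertType R} (T : I -> K).

Lemma in_span_comb c x y : in_span T x -> in_span T y -> in_span T (c *: x + y).
Proof.
move=> Tx Ty e e0; have c1 : 0 < normc c + 1 by rewrite ltr_wpDl ?normc_ge0.
have e2 : 0 < e / 2 by rewrite divr_gt0.
have [s xs] := Tx _ (divr_gt0 e2 c1); have [t yt] := Ty _ e2.
exists (cscale c s ++ t); rewrite lcomb_cat lcomb_scale opprD addrACA -scalerBr.
apply: le_lt_trans (ler_rnormD _ _) _; rewrite rnormZ [e]splitr.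
apply: ler_ltD => //; move: xs; rewrite ltr_pdivlMr//.
have := rnorm_ge0 (x - lcomb T s); lra.
Qed.

Lemma in_span_image (A : K -> K) x : bounded_linear A ->
  (forall i, exists j, A (T i) = T j) -> in_span T x -> in_span T (A x).
Proof.
move=> bA /choice[f fP] Tx e e0; have [r r0 rA] := bounded_linear_ge0 bA.
have r1 : 0 < r + 1 by rewrite ltr_wpDl.
have [s xs] := Tx _ (divr_gt0 e0 r1); exists [seq (p.1, f p.2) | p <- s].
have -> : lcomb T [seq (p.1, f p.2) | p <- s] = A (lcomb T s).
  rewrite (lcomb_linear _ _ bA.1) /lcomb big_map.
  by apply: eq_bigr => p _ /=; rewrite fP.
rewrite -(linB bA.1); apply: le_lt_trans (rA _) _.
move: xs; rewrite ltr_pdivlMr//; have := rnorm_ge0 (x - lcomb T s); lra.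
Qed.

Lemma in_span_mem i : in_span T (T i).
Proof. by move=> e e0; exists [:: (1, i)]; rewrite lcomb1 subrr rnorm0. Qed.

Lemma in_span_ext x y : in_span T x -> in_span T y ->
  (forall i, ip x (T i) = ip y (T i)) -> x = y.
Proof.
move=> Tx Ty xy; apply/eqP; rewrite -subr_eq0; apply/eqP.
apply: rnorm_eq0; apply/eqP; rewrite -sqrf_eq0 -ripxx /rip.
rewrite (in_span_orthogonal (_ : in_span T (x - y))) ?eqxx//.
  by rewrite addrC -scaleN1r; exact: in_span_comb.
by move=> i; rewrite ipBl xy subrr.
Qed.

Lemma projection_exists : exists Q : K -> K, [/\ bounded_linear Q,
  forall x i, ip (Q x) (T i) = ip x (T i), forall x, in_span T (Q x) &
  forall i, Q (T i) = T i].
Proof.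
have /choice[Q QP] : forall x : K, exists p, [/\ forall i, ip p (T i) = ip x (T i),
    in_span T p & rnorm p <= rnorm x].
  move=> x; apply: riesz; first exact: rnorm_ge0.
  by move=> s; rewrite -(ip_lcombr x T); exact: normc_ip_le.
exists Q; split.
- split; last by exists 1 => x; rewrite mul1r; case: (QP x).
  move=> c x y; case: (QP x) (QP y) (QP (c *: x + y)) => [h1 s1 _] [h2 s2 _] [h3 s3 _].
  apply: in_span_ext => //; first exact: in_span_comb.
  by move=> i; rewrite h3 !ipDl !ipZl h1 h2.
- by move=> x; case: (QP x).
- by move=> x; case: (QP x).
- by move=> i; case: (QP (T i)) => h s _; apply: in_span_ext => //; exact: in_span_mem.
Qed.

End Projection.

(** * The interior tensor product with H *)

Section InteriorTensor.
Context {R : realType} {H : hilbertType R} {M : vonNeumannAlgebra H}.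

(* X (x)_M H up to isomorphism, [it x] being the operator h |-> x (x) h. *)
Record interior_tensor (X : preHilbertModule M) := InteriorTensor {
  it_space :> hilbertType R;
  it : X -> H -> it_space;
  it_total : total (fun p : X * H => it p.1 p.2);
  it_ip : forall x h y k, ip (it x h) (it y k) = ip h (mip x y k)
}.

Lemma interior_tensor_exists (X : preHilbertModule M) : exists T : interior_tensor X, True.
Proof.
pose k (p q : X * H) := ip p.2 (mip p.1 q.1 q.2).
have [||K [T [tT TT]]] := @kolmogorov R (X * H) k.
- by move=> p q; exact: ip_mipC.
- move=> s; have := @mform_ge0 R H M X [seq (p.2.1, p.1 *: p.2.2) | p <- s].
  congr (0 <= _); rewrite /mform big_map; apply: eq_bigr => p _.
  rewrite big_map; apply: eq_bigr => q _ /=.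
  by rewrite (linZ (vn_linear (mip_in _ _))) ipZr ipZl mulrCA.
unshelve eexists; last by [].
apply: (@InteriorTensor X K (fun x h => T (x, h))).
  by move=> x xT; apply: tT => -[y h]; exact: (xT (y, h)).
by move=> x h y l; rewrite TT.
Qed.

Section Theory.
Context {X : preHilbertModule M} (T : interior_tensor X).
Implicit Types (x y : X) (h k : H).

Lemma it_ext (u v : T) : (forall y k, ip u (it T y k) = ip v (it T y k)) -> u = v.
Proof. by move=> uv; apply: (total_ext (@it_total X T)) => -[y k]; exact: uv. Qed.

Lemma it_linearl h : linear (fun x => it T x h).
Proof.
move=> c x y; apply: it_ext => z k; rewrite ipDl ipZl !it_ip.
by rewrite ip_mipC mip_linear !fctE ipDr ipZr rmorphD rmorphM /= -!ip_mipC.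
Qed.

Lemma it_linearr x : linear (it T x).
Proof.
by move=> c h k; apply: it_ext => z l; rewrite ipDl ipZl !it_ip ipDl ipZl.
Qed.

Lemma it_ract x a h : M a -> it T (ract x a) h = it T x (a h).
Proof.
move=> Ma; apply: it_ext => z k; rewrite !it_ip.
by rewrite -{1}[z]ract1 ip_mip_ract//; exact: vn_id.
Qed.

Lemma it_rnorm_sqr x h : rnorm (it T x h) ^+ 2 = rip h (mip x x h).
Proof. by rewrite -ripxx /rip it_ip. Qed.

Lemma it_rnorm_le x h : rnorm (it T x h) <= hmnorm x * rnorm h.
Proof.
rewrite -(@ler_pXn2r _ 2) ?nnegrE ?mulr_ge0 ?sqrtr_ge0 ?rnorm_ge0//.
have bx := vn_bounded (mip_in x x).
rewrite it_rnorm_sqr exprMn sqr_sqrtr ?opnorm_ge0//.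
apply: le_trans (rip_le _ _) _; rewrite expr2 mulrA mulrC.
by rewrite ler_wpM2r ?rnorm_ge0// rnorm_opnorm.
Qed.

Lemma it_bounded x : bounded_linear (it T x).
Proof. by split; [exact: it_linearr|exists (hmnorm x) => h; exact: it_rnorm_le]. Qed.

Lemma it_inj x y : (forall h, it T x h = it T y h) -> x = y.
Proof.
move=> xy; apply/eqP; rewrite -subr_eq0; apply/eqP/mip_eq0/funext => h.
apply: ip_extr => k; rewrite -(it_ip T) (linB (it_linearl k)) xy subrr ip0l.
by rewrite ip0r.
Qed.

(** The formal adjoint of I (x) d is I (x) d', because d' commutes with all values <x, y>. The
    growth required by [adjointable_extension] is that of the powers of [d \o d'] on H. *)
Lemma commutant_ampliation d d' : commutant M d -> commutant M d' ->
  (forall h k, ip (d h) k = ip h (d' k)) ->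
  exists D : T -> T, [/\ bounded_linear D,
    forall x h, D (it T x h) = it T x (d h) &
    forall u x h, ip (D u) (it T x h) = ip u (it T x (d' h))].
Proof.
move=> Md Md' dd'.
have [r r0 rd] := bounded_linear_ge0 (commutant_bounded Md).
have [r' r'0 rd'] := bounded_linear_ge0 (commutant_bounded Md').
pose p (i : X * H) := (i.1, d i.2); pose q (i : X * H) := (i.1, d' i.2).
have adjdd' x h y k : ip (it T x (d h)) (it T y k) = ip (it T x h) (it T y (d' k)).
  by rewrite !it_ip dd' (vn_commute _ (mip_in x y) Md').
have iterE n j : iter n (p \o q) j = (j.1, iter n (d \o d') j.2).
  by elim: n => [|n IH]; [case: j|rewrite !iterS IH].
have iter_le n k : rnorm (iter n (d \o d') k) <= (r * r') ^+ n * rnorm k.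
  elim: n => [|n IH]; first by rewrite expr0 mul1r.
  rewrite iterS /= exprS -!mulrA; apply: le_trans (rd _) _; rewrite ler_wpM2l//.
  by apply: le_trans (rd' _) _; rewrite ler_wpM2l.
have [|||L [bL LP]] := @adjointable_extension R _ T _ p q (r * r') (@it_total X T).
- by rewrite mulr_ge0.
- by move=> [x h] [y k]; exact: adjdd'.
- move=> [x h] [y k]; exists (hmnorm x * rnorm h * hmnorm y * rnorm k) => n.
  rewrite iterE /= (le_trans (normc_ip_le _ _))//.
  apply: le_trans (_ : (hmnorm x * rnorm h) * (hmnorm y * ((r * r') ^+ n * rnorm k)) <= _).
    apply: ler_pM; rewrite ?rnorm_ge0 ?it_rnorm_le//.
    apply: le_trans (it_rnorm_le _ _) _; rewrite ler_wpM2l ?sqrtr_ge0//.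
  by rewrite le_eqVlt; apply/orP; left; apply/eqP; ring.
exists L; split=> // [x h|u x h]; last exact: (LP u (x, h)).
by apply: it_ext => y k; rewrite (LP _ (y, k)) adjdd'.
Qed.

End Theory.

(** Commutation of A with I (x) d, written in matrix coefficients so that no choice of ampliations
    enters. *)
Definition intertwiner (X Y : preHilbertModule M) (S : interior_tensor X)
    (T : interior_tensor Y) (A : S -> T) : Prop :=
  bounded_linear A /\
  forall d d', commutant M d -> commutant M d' ->
    (forall h k, ip (d h) k = ip h (d' k)) ->
    forall z h y k, ip (it T z h) (A (it S y (d k))) = ip (it T z (d' h)) (A (it S y k)).

(* h |-> A^* (z (x) h) intertwines the commutant, so y |-> (z (x) .)^* A (y (x) .)
   is a bounded module map into M'' = M. *)
Lemma intertwiner_self_dual (X Y : preHilbertModule M) (S : interior_tensor X)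
    (T : interior_tensor Y) (A : S -> T) (z : Y) :
  self_dual X -> intertwiner A ->
  exists c : X, forall h y k, ip (it T z h) (A (it S y k)) = ip (it S c h) (it S y k).
Proof.
move=> sX [bA cA]; have [Z [bZ ZP]] := adjoint_exists (it_bounded T z).
pose psi y : H -> H := Z \o (A \o it S y).
have psiP h y k : ip h (psi y k) = ip (it T z h) (A (it S y k)) by rewrite ZP.
have [r r0 rA] := bounded_linear_ge0 bA; have [s s0 sZ] := bounded_linear_ge0 bZ.
have [c cP] : exists c : X, forall y, psi y = mip c y.
  apply: sX; split.
  - move=> y _; apply/vnP; split.
      by do 2![apply: bounded_linear_comp => //]; exact: it_bounded.
    move=> d Md k; have [d' Md' dd'] := commutant_adjoint Md.
    apply: ip_extr => h; rewrite psiP (cA d d')// -psiP.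
    by rewrite ip_conj -dd' -ip_conj.
  - move=> c x y _ _; apply/funext => k; apply: ip_extr => h.
    by rewrite !fctE ipDr ipZr !psiP (it_linearl S) bA.1 ipDr ipZr.
  - move=> x a _ Ma; apply/funext => k; apply: ip_extr => h.
    by rewrite psiP -[(psi x \o a) k]/(psi x (a k)) psiP it_ract.
  - exists (s * r) => y _; apply: opnorm_le.
      by rewrite !mulr_ge0// sqrtr_ge0.
    move=> k; apply: le_trans (sZ _) _; rewrite -!mulrA ler_wpM2l//.
    by apply: le_trans (rA _) _; rewrite ler_wpM2l// it_rnorm_le.
by exists c => h y k; rewrite -psiP cP it_ip.
Qed.

(** The projection Q onto the closed span of the e_i (x) h commutes with M', so self-duality
    represents y |-> z^* Q y by some c in X. As c and z agree against every e_i, c = z; thus Q fixes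
    every z (x) h. *)
Theorem separating_total I (X : preHilbertModule M) (T : interior_tensor X)
    (e : I -> X) :
  self_dual X -> (forall g, (forall i, mip g (e i) = 0) -> g = 0) ->
  total (fun p : I * H => it T (e p.1) p.2).
Proof.
move=> sX eX; set F := fun p : I * H => _.
have [Q [bQ QP Qs QF]] := projection_exists F.
have cQ : intertwiner Q.
  split=> // d d' Md Md' dd' z h y k.
  have [D [bD DT DP]] := commutant_ampliation T Md Md' dd'.
  have d'd h' k' : ip (d' h') k' = ip h' (d k').
    by rewrite ip_conj -dd' -ip_conj.
  rewrite -DT.
  (* The span is invariant under D, and under its adjoint, which acts by d'; hence Q and D
     commute. *)
  have -> : Q (D (it T y k)) = D (Q (it T y k)).
    apply: (@in_span_ext _ _ _ F).
    - exact: Qs.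
    - apply: in_span_image => // -[i l]; exists (i, d l).
      by rewrite /F DT.
    - by move=> [i l]; rewrite QP !DP -[it T (e i) _]/(F (i, d' l)) QP.
  by rewrite ip_conj DP -ip_conj.
have QC u v : ip (Q u) v = ip u (Q v).
  have uQ w : ip (w - Q w) (Q v) = 0 /\ ip (Q u) (w - Q w) = 0.
    have h1 i : ip (w - Q w) (F i) = 0 by rewrite ipBl QP subrr.
    split; first exact: in_span_orthogonal (Qs v) h1.
    by rewrite ip_conj (in_span_orthogonal (Qs u) h1) rmorph0.
  rewrite -{1}(subrK (Q v) v) ipDr (uQ v).2 add0r.
  by rewrite -{2}(subrK (Q u) u) ipDl (uQ u).1 add0r.
have Qid z h : Q (it T z h) = it T z h.
  have [c cP] := intertwiner_self_dual z sX cQ.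
  have zc : c = z.
    apply/eqP; rewrite -subr_eq0; apply/eqP/eX => i; apply/funext => k.
    apply: ip_extr => l; rewrite ip0r -(it_ip T) (linB (it_linearl T l)) ipBl.
    by rewrite -cP -[it T (e i) k]/(F (i, k)) QF subrr.
  by apply: it_ext => y k; rewrite QC cP zc.
move=> u uF; have Qu : Q u = 0.
  by apply: (@in_span_ext _ _ _ F (Q u) 0) => [//||i]; [
    move=> r r0; exists [::]; rewrite /lcomb big_nil subr0 rnorm0 |
    rewrite QP uF ip0l].
by apply: (@it_total X T) => -[z h] /=; rewrite -Qid -(QC u) Qu ip0l.
Qed.

End InteriorTensor.

(** * Left actions and GNS correspondences *)

Section LeftAction.
Context {R : realType} {H : hilbertType R} {M : vonNeumannAlgebra H}.
Implicit Types X : wCorrespondence M.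

Lemma ip_mip_lact X (x y : X) c h k : M c ->
  ip h (mip (lact c x) y k) = ip h (mip x (lact (adj c) y) k).
Proof. by move=> Mc; rewrite lact_adj. Qed.

(** The constant may depend on [i] and [j], since [adjointable_extension] only sees the exponential
    rate. Elementary tensors have such bounds by contractivity. *)
Definition left_bounded I X (e : I -> X) : Prop := forall i j, exists C : R,
  forall s, M s -> forall h k,
  normc (ip h (mip (e i) (lact s (e j)) k)) <= C * opnorm s * rnorm h * rnorm k.

(** The actions of c and [adj c] move the indices of the family and are formally adjoint. *)
Lemma left_ampliation I X (T : interior_tensor X) (e : I -> X) c :
  total (fun p : I * H => it T (e p.1) p.2) ->
  (forall c i, M c -> exists j, lact c (e i) = e j) -> left_bounded e ->
  M c -> exists L : T -> T, bounded_linear L /\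
    forall x h, L (it T x h) = it T (lact c x) h.
Proof.
move=> eT ce Ce Mc; have [Mc' cc'] := vn_adjoint Mc.
have [f fP] := choice (fun i => ce c i Mc).
have [f' f'P] := choice (fun i => ce (adj c) i Mc').
have [r r0 rc] := bounded_linear_ge0 (vn_bounded Mc).
have [r' r'0 rc'] := bounded_linear_ge0 (vn_bounded Mc').
pose p (i : I * H) := (f i.1, i.2); pose q (i : I * H) := (f' i.1, i.2).
have adjcc x h y k : ip (it T (lact c x) h) (it T y k) =
    ip (it T x h) (it T (lact (adj c) y) k).
  by rewrite !it_ip ip_mip_lact.
(* The n-th power of [c \o adj c], as an element of M: the iterates on the family are its left
   actions, so [left_bounded] controls them. *)
pose sn n := iter n (fun a => c \o (adj c \o a)) id.
have Msn n : M (sn n).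
  by elim: n => [|n IH]; [exact: vn_id|exact: vn_comp Mc (vn_comp Mc' IH)].
have sn_le n : opnorm (sn n) <= (r * r') ^+ n.
  apply: opnorm_le; first by rewrite exprn_ge0// mulr_ge0.
  elim: n => [|n IH] x; first by rewrite expr0 mul1r.
  rewrite /sn iterS -/(sn n) exprS -!mulrA; apply: le_trans (rc _) _.
  by rewrite ler_wpM2l//; apply: le_trans (rc' _) _; rewrite ler_wpM2l.
have iterE n j : e (iter n (p \o q) j).1 = lact (sn n) (e j.1) /\
    (iter n (p \o q) j).2 = j.2.
  elim: n => [|n [IH IH2]]; first by rewrite /= lact1.
  have -> : sn n.+1 = c \o (adj c \o sn n) by [].
  rewrite iterS /= -fP -f'P IH IH2; split=> //.
  by rewrite (lactM _ Mc (vn_comp Mc' (Msn n))) (lactM _ Mc' (Msn n)).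
have [|||L [bL LP]] := @adjointable_extension R _ T _ p q (r * r') eT.
- by rewrite mulr_ge0.
- by move=> [i h] [j k]; rewrite /= -fP -f'P adjcc.
- move=> [i h] [j k]; have [C CP] := Ce i j.
  exists (`|C| * rnorm h * rnorm k) => n /=.
  have [-> ->] := iterE n (j, k); rewrite it_ip; apply: le_trans (CP _ (Msn n) h k) _.
  rewrite [leRHS]mulrC !mulrA ler_wpM2r ?rnorm_ge0// ler_wpM2r ?rnorm_ge0//.
  apply: le_trans (_ : `|C| * opnorm (sn n) <= _).
    by rewrite ler_wpM2r ?ler_norm// opnorm_ge0//; exact: vn_bounded (Msn n).
  by rewrite [leRHS]mulrC ler_wpM2l.
exists L; split=> // x h; apply: (total_ext eT) => -[j k] /=.
by rewrite (LP _ (j, k)) /= -f'P adjcc.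
Qed.

End LeftAction.

(** * Separation by the generators of a self-dual extension *)

Section SelfDualExtension.
Context {R : realType} {H : hilbertType R} {M : vonNeumannAlgebra H}.
Implicit Types X : preHilbertModule M.

Lemma mip_norm_closure X (g x : X) (S : set X) :
  (forall y, S y -> mip g y = 0) -> norm_closure S x -> mip g x = 0.
Proof.
move=> gS xS; have [T _] := interior_tensor_exists X.
apply/funext => k; apply: ip_extr => h; rewrite ip0r -(it_ip T).
apply: eq0_normc; apply/eqP; rewrite eq_le normc_ge0 andbT.
apply: (@le_of_forall_inv _ _ _ (rnorm (it T g h) * rnorm k)) => n.
have [y /gS gy xy] := xS _ (harmonic_gt0 n).
have -> : ip (it T g h) (it T x k) = ip (it T g h) (it T (x - y) k).
  by rewrite (linB (it_linearl T k)) ipBr [X in _ - X]it_ip gy ip0r subr0.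
rewrite add0r (le_trans (normc_ip_le _ _))// -mulrA ler_wpM2l ?rnorm_ge0//.
by apply: le_trans (it_rnorm_le _ _ _) _; rewrite mulrC ler_wpM2l ?rnorm_ge0// ltW.
Qed.

(** Both g and 0 represent the zero map on the closure of S, and representing elements are
    unique. *)
Lemma self_dual_extension_separating X (S : set X) :
  is_self_dual_extension (norm_closure S) ->
  forall g, (forall y, S y -> mip g y = 0) -> g = 0.
Proof.
move=> [_ /(_ (fun=> 0))[]].
  split=> [x _|c x y _ _|x a _ _|]; first exact: vn0.
  - by rewrite scaler0 addr0.
  - by [].
  - exists 0 => x _; rewrite mul0r; apply: opnorm_le => // h.
    by rewrite rnorm0 mul0r.
move=> z [_ zu] g gS; rewrite -(zu g); last first.
  by move=> x xS; rewrite (mip_norm_closure gS xS).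
apply: zu => x _; apply/esym/funext => k; apply: ip_extr => h.
by rewrite ip_mipC (lin0 (mip_linear x)) !ip0r rmorph0.
Qed.

End SelfDualExtension.

Section GNSBounds.
Context {R : realType} {H : hilbertType R} {M : vonNeumannAlgebra H}.
Context (Theta : (H -> H) -> (H -> H)) (hTheta : cp_map M Theta).
Context (E : GNS M Theta).

(** Indexed by subtypes, because [gns_t] is constrained only on M. *)
Definition gns_elem (i : {a | M a} * {b | M b}) : E := gns_t E (sval i.1) (sval i.2).

Lemma gns_separating (g : E) :
  (forall a b, M a -> M b -> mip g (gns_t E a b) = 0) -> g = 0.
Proof.
move=> gE; apply: (self_dual_extension_separating (gns_extension E)) => _ [n [a [b [ab ->]]]].
rewrite (lin_sum (mip_linear g)) big1// => i _.
by apply: gE; case: (ab i).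
Qed.

Lemma opnorm_comp (a b : H -> H) : bounded_linear a -> bounded_linear b ->
  opnorm (a \o b) <= opnorm a * opnorm b.
Proof.
move=> ba bb; apply: opnorm_le; first by rewrite mulr_ge0 ?opnorm_ge0.
move=> x /=; apply: le_trans (rnorm_opnorm _ ba) _; rewrite -mulrA.
by rewrite ler_wpM2l ?opnorm_ge0// rnorm_opnorm.
Qed.

Lemma normc_ip_sandwich (a b c : H -> H) h k :
  bounded_linear a -> bounded_linear b -> bounded_linear c ->
  normc (ip h (a (b (c k)))) <= opnorm a * opnorm c * opnorm b * rnorm h * rnorm k.
Proof.
move=> ba bb bc; apply: le_trans (normc_ip_le _ _) _.
have a0 := opnorm_ge0 ba; have b0 := opnorm_ge0 bb; have h0 := rnorm_ge0 h.
apply: le_trans (_ : rnorm h * (opnorm a * (opnorm b * (opnorm c * rnorm k))) <= _).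
  rewrite ler_wpM2l//; apply: le_trans (rnorm_opnorm _ ba) _; rewrite ler_wpM2l//.
  by apply: le_trans (rnorm_opnorm _ bb) _; rewrite ler_wpM2l// rnorm_opnorm.
by rewrite le_eqVlt; apply/orP; left; apply/eqP; ring.
Qed.

Lemma cp_sandwich_bound a a' : M a -> M a' -> exists2 C : R, 0 <= C &
  forall s, M s -> opnorm (Theta (a \o (s \o a'))) <= C * opnorm s.
Proof.
move=> Ma Ma'; exists (opnorm a * opnorm a').
  by rewrite mulr_ge0 ?opnorm_ge0//; [exact: vn_bounded Ma|exact: vn_bounded Ma'].
move=> s Ms; apply: le_trans (cp_contractive hTheta _) _; first exact: vn_comp Ma (vn_comp Ms Ma').
have [ba [bs ba']] := (vn_bounded Ma, (vn_bounded Ms, vn_bounded Ma')).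
apply: le_trans (opnorm_comp ba (bounded_linear_comp bs ba')) _.
rewrite -mulrA ler_wpM2l ?opnorm_ge0// mulrC.
exact: opnorm_comp.
Qed.

Lemma gns_mip_lact (a b a' b' s : H -> H) : M a -> M b -> M a' -> M b' -> M s ->
  mip (gns_t E a b) (lact s (gns_t E a' b')) =
  adj b \o Theta (adj a \o (s \o a')) \o b'.
Proof.
move=> Ma Mb Ma' Mb' Ms; rewrite gns_lact// gns_mip//; exact: vn_comp.
Qed.

Lemma gns_left_bounded : left_bounded gns_elem.
Proof.
move=> [[a Ma] [b Mb]] [[a' Ma'] [b' Mb']]; rewrite /gns_elem /=.
have [Ma1 _] := vn_adjoint Ma; have [Mb1 _] := vn_adjoint Mb.
have [C C0 CP] := cp_sandwich_bound Ma1 Ma'.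
exists (opnorm (adj b) * opnorm b' * C) => s Ms h k.
rewrite gns_mip_lact//=.
have Ms' : M (Theta (adj a \o (s \o a'))).
  by exact: (cp_stable hTheta) (vn_comp Ma1 (vn_comp Ms Ma')).
apply: le_trans (normc_ip_sandwich _ _ (vn_bounded Mb1) (vn_bounded Ms') (vn_bounded Mb')) _.
rewrite ler_wpM2r ?rnorm_ge0// ler_wpM2r ?rnorm_ge0//.
rewrite -[leRHS]mulrA ler_wpM2l ?CP// mulr_ge0// opnorm_ge0//.
  exact: vn_bounded Mb1.
exact: vn_bounded Mb'.
Qed.

Lemma gns_total (T : interior_tensor E) :
  total (fun p : _ * H => it T (gns_elem p.1) p.2).
Proof.
apply: separating_total; first exact: wc_self_dual.
move=> g gE; apply: gns_separating => a b Ma Mb.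
exact: (gE (exist _ a Ma, exist _ b Mb)).
Qed.

Lemma gns_left_ampliation (T : interior_tensor E) c : M c ->
  exists L : T -> T, bounded_linear L /\
    forall x h, L (it T x h) = it T (lact c x) h.
Proof.
move=> Mc; apply: (@left_ampliation _ _ _ _ E T gns_elem c) => //.
- exact: gns_total.
- move=> {Mc}c [[a Ma] [b Mb]] Mc.
  by exists (exist _ (c \o a) (vn_comp Mc Ma), exist _ b Mb); rewrite /gns_elem gns_lact.
- exact: gns_left_bounded.
Qed.

End GNSBounds.

(** * Sigma-strong density *)

Section Sums.
Context {R : realType}.

Lemma ler_sum_nat_wide (f : nat -> R) m n : (forall i, 0 <= f i) -> (m <= n)%N ->
  \sum_(0 <= i < m) f i <= \sum_(0 <= i < n) f i.
Proof.
by move=> f0 mn; rewrite [leRHS](big_cat_nat (n := m))//= lerDl sumr_ge0.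
Qed.

Lemma rnorm_le_ip (H : hilbertType R) (v : H) (C : R) : 0 <= C ->
  (forall h, normc (ip h v) <= C * rnorm h) -> rnorm v <= C.
Proof.
move=> C0 /(_ v); rewrite ipxx normc_real ger0_norm ?sqr_ge0//.
have [->//|vn0] := eqVneq (rnorm v) 0.
by rewrite expr2 ler_pM2r// lt_neqAle eq_sym vn0 rnorm_ge0.
Qed.

End Sums.

Section StrongDensity.
Context {R : realType} {H : hilbertType R} {M : vonNeumannAlgebra H}.
Context (X : preHilbertModule M) (T : interior_tensor X) (S : set X).

(* Take y_m in x + S almost minimising sum_n |y h_n|^2. Moving along s <s, y_m>
   shows <s, y_m> h_n -> 0 for every s in S, while y_m h_n converges by the
   parallelogram law; as S H is total the limit is 0. *)
Theorem strong_density :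
  (forall c x y, S x -> S y -> S (c *: x + y)) ->
  (forall x a, S x -> M a -> S (ract x a)) ->
  S !=set0 ->
  (forall u : T, (forall x k, S x -> ip u (it T x k) = 0) -> u = 0) ->
  forall (x : X) (h : nat -> H) (C : R),
    (forall N, \sum_(0 <= n < N) rnorm (h n) ^+ 2 <= C) ->
  forall e : R, 0 < e -> exists2 s, S s &
    forall N, \sum_(0 <= n < N) rnorm (it T (x - s) (h n)) ^+ 2 <= e.
Proof.
move=> Slin Sract [s0 Ss0] Stot x h C hC.
have S0 : S 0 by have := Slin (-1) _ _ Ss0 Ss0; rewrite scaleN1r addNr.
have SZ c s : S s -> S (c *: s) by move=> Ss; have := Slin c _ _ Ss S0; rewrite addr0.
pose q y n := rnorm (it T y (h n)) ^+ 2.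
have q0 y n : 0 <= q y n by rewrite sqr_ge0.
(* The infinite sum is at most [c], stated through partial sums. *)
pose Jle y c := forall N, \sum_(0 <= n < N) q y n <= c.
pose A := [set c | exists2 s, S s & Jle (x - s) c].
have hA : has_inf A.
  split.
    exists (hmnorm x ^+ 2 * C), 0 => // N; rewrite subr0.
    apply: le_trans (_ : \sum_(0 <= n < N) hmnorm x ^+ 2 * rnorm (h n) ^+ 2 <= _).
      apply: ler_sum => n _; rewrite -exprMn lerXn2r ?nnegrE ?it_rnorm_le//.
        exact: rnorm_ge0.
      by rewrite mulr_ge0 ?sqrtr_ge0 ?rnorm_ge0.
    by rewrite -mulr_sumr ler_wpM2l ?sqr_ge0.
  by exists 0 => c [s _ /(_ 0%N)]; rewrite big_geq.
pose d := inf A.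
have dJ s c : S s -> Jle (x - s) c -> d <= c.
  by move=> Ss Jc; apply: ge_inf; [case: hA|exists s].
have /choice[u uP] : forall m : nat, exists s, S s /\ Jle (x - s) (d + harmonic m).
  move=> m; have [c [s Ss Jc] cd] := @inf_adherent _ A _ (harmonic_gt0 m) hA.
  by exists s; split=> // N; apply: le_trans (Jc N) _; exact: ltW.
pose y m := x - u m.
have small s : S s -> exists2 r : R, 0 < r &
    forall m n, rnorm (mip s (y m) (h n)) ^+ 2 <= r * harmonic m.
  move=> Ss; pose r := hmnorm s ^+ 2 + 1.
  have r0 : 0 < r by rewrite ltr_wpDl ?sqr_ge0.
  exists r => // m n; pose a := mip s (y m).
  have Ma : M a := mip_in s (y m).
  (* A gradient step of length 1 / r. As r bounds the squared norm of s, the n-th term of the sum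
     drops by at least |a h_n|^2 / r. *)
  pose v := u m + r^-1%:C *: ract s a.
  have Sv : S v by rewrite /v addrC; apply: Slin; [exact: Sract|case: (uP m)].
  have qv j : q (x - v) j <= q (y m) j - rnorm (a (h j)) ^+ 2 / r.
    rewrite /q /v opprD addrA -/(y m) (linB (it_linearl T (h j))).
    rewrite (linZ (it_linearl T (h j))) it_ract// rnormB_sqr ripZr rnormZ.
    rewrite normc_real ger0_norm ?invr_ge0 ?(ltW r0)//.
    have -> : rip (it T (y m) (h j)) (it T s (a (h j))) = rnorm (a (h j)) ^+ 2.
      by rewrite ripC /rip it_ip -/a -ripxx.
    have : rnorm (it T s (a (h j))) ^+ 2 <= r * rnorm (a (h j)) ^+ 2.
      apply: le_trans (_ : (hmnorm s * rnorm (a (h j))) ^+ 2 <= _).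
        rewrite lerXn2r ?nnegrE ?it_rnorm_le ?rnorm_ge0//.
        by rewrite mulr_ge0 ?sqrtr_ge0 ?rnorm_ge0.
      by rewrite exprMn ler_wpM2r ?sqr_ge0// lerDl.
    rewrite exprMn.
    move: (rnorm (it T s _) ^+ 2) (rnorm (a _) ^+ 2) (rnorm (it T (y m) _) ^+ 2) => z w z' zw.
    have : r^-1 ^+ 2 * z <= r^-1 ^+ 2 * (r * w) by rewrite ler_wpM2l ?sqr_ge0.
    have -> : r^-1 ^+ 2 * (r * w) = w / r by field; rewrite gt_eqF.
    lra.
  have : d <= d + harmonic m - rnorm (a (h n)) ^+ 2 / r.
    apply: (dJ v) => // N; apply: le_trans (ler_sum_nat_wide _ (leq_maxl N n.+1)) _ => //.
    apply: le_trans (ler_sum _ (fun j _ => qv j)) _.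
    rewrite sumrB lerB ?(uP m).2//.
    rewrite (big_cat_nat (n := n))//=; last by rewrite leq_max leqnSn orbT.
    rewrite (big_ltn (m := n)) ?leq_max ?leqnn ?orbT//= addrCA lerDl.
    by rewrite addr_ge0 ?sumr_ge0// => j _; rewrite divr_ge0 ?sqr_ge0 ?(ltW r0).
  rewrite -addrA lerDl subr_ge0 ler_pdivrMr// mulrC; exact.
have para m l N : \sum_(0 <= n < N) q (y m - y l) n <= 2 * (harmonic m + harmonic l).
  pose v := (1 / 2)%:C *: (u m + u l).
  have Sv : S v.
    apply: SZ; have := Slin 1 _ _ (uP m).1 (uP l).1; by rewrite scale1r.
  have half : (1 / 2)%:C + (1 / 2)%:C = 1 :> R[i].
    by rewrite -rmorphD /= -mulrDl divff.
  have xv : x - v = (1 / 2)%:C *: (y m + y l).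
    rewrite /y /v addrACA -opprD scalerBr; congr (_ - _).
    by rewrite scalerDr -scalerDl half scale1r.
  have qE n : q (y m - y l) n = 2 * q (y m) n + 2 * q (y l) n - 4 * q (x - v) n.
    rewrite /q xv (linZ (it_linearl T (h n))) (linB (it_linearl T (h n)) (y m)).
    rewrite (linD (it_linearl T (h n)) (y m)) rnormZ exprMn normc_real.
    by rewrite real_normK ?num_real// rnormB_sqr rnormD_sqr; field.
  apply: (@le_of_forall_inv _ _ _ 4) => j.
  (* Otherwise d - 1/(j+1) would bound all partial sums at [v], against the choice of d as an
     infimum. *)
  have [N' HN'] : exists N', d - harmonic j < \sum_(0 <= n < N') q (x - v) n.
    apply/not_existsP => hN; have : d <= d - harmonic j.
      by apply: (dJ v) => // N'; rewrite leNgt; apply/negP/hN.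
    by rewrite lerBrDl gerDr leNgt harmonic_gt0.
  apply: le_trans (ler_sum_nat_wide _ (leq_maxl N N')) _ => //.
  under eq_bigr do rewrite qE.
  rewrite sumrB big_split /= -!mulr_sumr.
  have := lt_le_trans HN' (ler_sum_nat_wide (q0 _) (leq_maxr N N')).
  have := (uP m).2 (maxn N N'); have := (uP l).2 (maxn N N').
  rewrite -/(y m) -/(y l); lra.
have para1 m l n : rnorm (it T (y m) (h n) - it T (y l) (h n)) ^+ 2 <=
    2 * (harmonic m + harmonic l).
  apply: le_trans (para m l n.+1); rewrite big_nat_recr//= -(linB (it_linearl T (h n))).
  by rewrite lerDr sumr_ge0.
have to0 n (e : R) : 0 < e -> exists N, forall m, (N <= m)%N -> q (y m) n < e.
  have [z zP] : exists z : T, forall e : R, 0 < e ->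
      exists N, forall m, (N <= m)%N -> rnorm (it T (y m) (h n) - z) < e.
    apply: (@cauchy_sequence_cvg R T (fun m => it T (y m) (h n))) => {}e e0.
    have e4 : 0 < e ^+ 2 / 4 by rewrite divr_gt0 ?exprn_gt0.
    have [N HN] := archi_inv e4; exists N => m l Nm Nl.
    rewrite -(@ltr_pXn2r _ 2) ?nnegrE ?rnorm_ge0 ?(ltW e0)//.
    by apply: le_lt_trans (para1 m l n) _; have := HN _ Nm; have := HN _ Nl; lra.
  have z0 : z = 0.
    apply: Stot => s k Ss; have [r r0 sr] := small s Ss.
    apply/eq0_normc/eqP; rewrite eq_le normc_ge0 andbT.
    apply: (@le_of_forall_inv _ _ _ (rnorm (it T s k) + rnorm k)) => j.
    have hj := harmonic_gt0 j : 0 < harmonic j :> R.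
    have [N HN] := zP _ hj.
    have [N' HN'] := archi_inv (divr_gt0 (exprn_gt0 2 hj) r0).
    pose m := maxn N N'.
    have h1 : rnorm (z - it T (y m) (h n)) <= harmonic j.
      by rewrite rnormB ltW// HN// leq_maxl.
    have h2 : rnorm (mip s (y m) (h n)) <= harmonic j.
      rewrite -(@ler_pXn2r _ 2) ?nnegrE ?rnorm_ge0 ?(ltW hj)//.
      apply: le_trans (sr m n) _; rewrite -ler_pdivlMl// mulrC ltW// HN'//.
      exact: leq_maxr.
    rewrite -(subrK (it T (y m) (h n)) z) ipDl.
    apply: le_trans (le_normcD _ _) _; rewrite add0r mulrDl lerD//.
      apply: le_trans (normc_ip_le _ _) _; rewrite mulrC.
      by rewrite ler_wpM2l ?rnorm_ge0.
    rewrite ip_conj normcJ it_ip; apply: le_trans (normc_ip_le _ _) _.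
    by rewrite ler_wpM2l ?rnorm_ge0.
  move=> e0; have se : 0 < Num.sqrt e by rewrite sqrtr_gt0.
  have [N HN] := zP _ se; exists N => m Nm; have := HN m Nm.
  rewrite z0 subr0 -(@ltr_pXn2r _ 2) ?nnegrE ?rnorm_ge0 ?sqrtr_ge0//.
  by rewrite sqr_sqrtr ?ltW.
have sum0 N (e : R) : 0 < e ->
    exists L, forall l, (L <= l)%N -> \sum_(0 <= n < N) q (y l) n < e.
  elim: N e => [|N IH] e e0; first by exists 0%N => l _; rewrite big_geq.
  have e2 : 0 < e / 2 by rewrite divr_gt0.
  have [L HL] := IH _ e2; have [L' HL'] := to0 N _ e2.
  exists (maxn L L') => l; rewrite geq_max => /andP[Ll L'l].
  by rewrite big_nat_recr//= [e]splitr ltrD ?HL ?HL'.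
move=> e e0; have e4 : 0 < e / 4 by rewrite divr_gt0.
have [m /(_ m (leqnn m)) me] := archi_inv e4.
exists (u m); first by case: (uP m).
move=> N; rewrite -/(y m); apply: le_trans (_ : 4 * harmonic m <= _); last first.
  by move: me; lra.
(* Limit in l of |y_m|^2 <= 2 |y_m - y_l|^2 + 2 |y_l|^2, summed over n: the excess over
   [4 * harmonic m] is at most 4/(l+1) + 2/(j+1), where l >= j. *)
apply: (@le_of_forall_inv _ _ _ 6) => j.
have hj := harmonic_gt0 j : 0 < harmonic j :> R.
have [L HL] := sum0 N _ hj.
pose l := maxn L j.
have lj : harmonic l <= harmonic j :> R by rewrite lef_pV2 ?posrE// ler_nat ltnS /l leq_maxr.
have := HL l (leq_maxl _ _); have := para m l N.
have : \sum_(0 <= n < N) q (y m) n <=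
    2 * \sum_(0 <= n < N) q (y m - y l) n + 2 * \sum_(0 <= n < N) q (y l) n.
  rewrite !mulr_sumr -big_split /=; apply: ler_sum => n _.
  rewrite /q -{1}(subrK (y l) (y m)) (linD (it_linearl T (h n)) (y m - y l)).
  set v := it T (y m - y l) (h n); set w := it T (y l) (h n).
  have := sqr_ge0 (rnorm (v - w)); rewrite rnormB_sqr rnormD_sqr; lra.
lra.
Qed.

End StrongDensity.

(** * Normal maps *)

Section Series.
Context {R : realType}.

Lemma nneg_series_cvg (b : nat -> R) (C : R) : (forall n, 0 <= b n) ->
  (forall N, \sum_(0 <= n < N) b n <= C) -> cvgn (series b).
Proof.
move=> b0 bC; apply: nondecreasing_is_cvgn.
  by move=> m n mn; exact: ler_sum_nat_wide.
by exists C => _ [N _ <-]; exact: bC.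
Qed.

Lemma square_summableP (H : hilbertType R) (x : nat -> H) :
  square_summable x <-> exists C, forall N, \sum_(0 <= n < N) rnorm (x n) ^+ 2 <= C.
Proof.
split=> [cx|[C xC]]; last by apply: nneg_series_cvg xC => n; exact: sqr_ge0.
exists (limn (series (fun n => rnorm (x n) ^+ 2))) => N.
apply: (@nondecreasing_cvgn_le _ (series _)) => //.
by move=> m n mn; apply: ler_sum_nat_wide => // i; exact: sqr_ge0.
Qed.

Lemma complex_series_cvg (z : nat -> R[i]) (b : nat -> R) (C : R) :
  (forall n, normc (z n) <= b n) -> (forall N, \sum_(0 <= n < N) b n <= C) ->
  exists2 l : R[i], series (z : nat -> R[i]^o) @ \oo --> (l : R[i]^o) & normc l <= C.
Proof.
move=> zb bC; have b0 n : 0 <= b n by exact: le_trans (normc_ge0 _) (zb n).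
pose s N : R[i] := \sum_(0 <= n < N) z n.
have sB m n : (m <= n)%N ->
    normc (s n - s m) <= \sum_(0 <= i < n) b i - \sum_(0 <= i < m) b i.
  move=> mn; have cat (V : zmodType) (f : nat -> V) :
      \sum_(0 <= i < n) f i - \sum_(0 <= i < m) f i = \sum_(m <= i < n) f i.
    by rewrite (big_cat_nat (n := m))//= addrAC subrr add0r.
  rewrite !cat.
  elim/big_ind2 : _ => [|x1 x2 y1 y2 h1 h2|i _]; first by rewrite normc0.
    by rewrite (le_trans (le_normcD _ _))// lerD.
  exact: zb.
have /cvg_ex[B BP] := nneg_series_cvg b0 bC.
have [l lP] : exists l, forall e : R, 0 < e -> exists N, forall n, (N <= n)%N ->
    normc (s n - l) < e.
  apply: complex_cauchy_cvg => e e0; have e2 : 0 < e / 2 by rewrite divr_gt0.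
  have /cvgrPdist_lt /(_ _ e2)[N _ HN] := BP.
  exists N => m n Nm Nn; wlog mn : m n Nm Nn / (m <= n)%N.
    move=> wl; have [mn|/ltnW nm] := leqP m n; first exact: wl.
    by rewrite normcB; exact: wl.
  rewrite normcB; apply: le_lt_trans (sB _ _ mn) _.
  have := HN m Nm; have := HN n Nn; rewrite /= !ltr_norml /series /=.
  move=> /andP[h1 h2] /andP[h3 h4]; lra.
exists l.
  apply/cvgrPdist_lt => e' /gt0_complexP[e e0 ->]; have [N HN] := lP e e0.
  exists N => // n /= Nn; rewrite normcE_normr ltcR normcB.
  exact: HN.
apply: (@le_of_forall_inv _ _ _ 1) => j.
have [N HN] := lP _ (harmonic_gt0 j); have := HN N (leqnn N).
rewrite mul1r normcB -{2}(subrK (s N) l) => h.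
apply: le_trans (le_normcD _ _) _; rewrite addrC; apply: lerD; last exact: ltW.
apply: le_trans (bC N); have := sB 0%N N (leq0n N).
by rewrite {1}/s [X in s N - X]big_geq// subr0 [X in _ <= _ - X]big_geq// subr0.
Qed.

(** Merging two sequences turns two smallness conditions into one; this gives intersections in the
    filter of [normal_small]. *)
Definition interleave (T : Type) (x y : nat -> T) n := if odd n then y n./2 else x n./2.

Lemma sum_interleave T (g : T -> R) (x y : nat -> T) N :
  \sum_(0 <= n < N.*2) g (interleave x y n) =
  \sum_(0 <= n < N) g (x n) + \sum_(0 <= n < N) g (y n).
Proof.
elim: N => [|N IH]; first by rewrite !big_geq// addr0.
rewrite doubleS !big_nat_recr//= IH /interleave /= odd_double /= uphalf_double.
by rewrite doubleK; ring.
Qed.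

Lemma le_sum_interleave T (g : T -> R) (x y : nat -> T) (C : R) :
  (forall t, 0 <= g t) ->
  (forall N, \sum_(0 <= n < N) g (interleave x y n) <= C) ->
  forall N, \sum_(0 <= n < N) g (x n) + \sum_(0 <= n < N) g (y n) <= C.
Proof. by move=> g0 gC N; rewrite -sum_interleave. Qed.

End Series.

Section NormalMaps.
Context {R : realType} {H : hilbertType R} {M : vonNeumannAlgebra H}.

Lemma square_summable_interleave (x y : nat -> H) :
  square_summable x -> square_summable y -> square_summable (interleave x y).
Proof.
move=> /square_summableP[C xC] /square_summableP[D yD]; apply/square_summableP.
exists (C + D) => N.
apply: le_trans (@ler_sum_nat_wide _ _ N N.*2 _ _) _.
- by move=> n; exact: sqr_ge0.
- by rewrite -addnn leq_addr.
by rewrite (sum_interleave (fun h : H => rnorm h ^+ 2)) lerD.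
Qed.

Lemma positive_op_ip_le (a : H -> H) x y : linear a -> is_adjoint a a ->
  positive_op a -> normc (ip x (a y)) <= rip x (a x) + rip y (a y).
Proof.
move=> la aa a0; set z := ip x (a y).
have [z0|z0] := eqVneq z 0.
  rewrite z0 normc0 addr_ge0//.
    by have := a0 x; rewrite lecE => /andP[].
  by have := a0 y; rewrite lecE => /andP[].
have nz : 0 < normc z.
  by rewrite lt_neqAle normc_ge0 andbT eq_sym; apply/contra_neq: z0; exact: eq0_normc.
(* The phase for which the cross term of <x + c y, a (x + c y)> is -2 |z|. *)
pose c := - (normc z)^-1%:C * z^*.
have nc : normc c = 1.
  by rewrite /c normcM normcN normc_real normcJ ger0_norm ?invr_ge0 ?(ltW nz)// mulVf// gt_eqF.
have := a0 (x + c *: y); rewrite lecE => /andP[_].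
rewrite -/(rip _ _) (linD la) (linZ la) ripDl !ripDr.
have -> : rip (c *: y) (a x) = rip x (c *: a y).
  by rewrite ripC /rip aa (linZ la).
have -> : rip (c *: y) (c *: a y) = rip y (a y).
  by rewrite /rip ipZl ipZr mulrA normc_sqrE nc expr1n mul1r.
have -> : rip x (c *: a y) = - normc z.
  rewrite /rip ipZr -/z /c -mulrA normc_sqrE mulNr -rmorphM ReN /=.
  by rewrite expr2 mulrA mulVf ?mul1r// gt_eqF.
rewrite /=; lra.
Qed.

(* The sets {a >= 0 | sum_n <x_n, a x_n> <= d} are a basis of a filter converging
   to 0 sigma-weakly. *)
Lemma normal_small (f : (H -> H) -> (H -> H)) : normal_on M f -> f 0 = 0 ->
  forall (k : H) (e : R), 0 < e -> exists x : nat -> H, square_summable x /\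
    exists2 d : R, 0 < d & forall a, M a -> is_adjoint a a -> positive_op a ->
      (forall N, \sum_(0 <= n < N) rip (x n) (a (x n)) <= d) ->
      normc (ip k (f a k)) < e.
Proof.
move=> nf f0 k e e0.
pose B (x : nat -> H) (d : R) : set (H -> H) := [set a | [/\ M a, is_adjoint a a,
  positive_op a & forall N, \sum_(0 <= n < N) rip (x n) (a (x n)) <= d]].
pose F : set_system (H -> H) := [set P | exists x, square_summable x /\
  exists2 d : R, 0 < d & B x d `<=` P].
have ss0 : square_summable (fun=> 0 : H).
  apply/square_summableP; exists 0 => N; rewrite big1// => n _.
  by rewrite rnorm0 expr0n.
have B0 x d : 0 < d -> B x d 0.
  move=> d0; split; first exact: vn0.
  - by move=> u v; rewrite ip0l ip0r.
  - by move=> u; rewrite ip0r.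
  - by move=> N; rewrite big1 ?(ltW d0)// => n _; rewrite rip0r.
have rip_ge0 x d a u : B x d a -> 0 <= rip u (a u).
  by move=> [_ _ /(_ u)]; rewrite lecE => /andP[].
have FF : ProperFilter F.
  split; first by move=> [x [_ [d d0 /(_ 0 (B0 x d d0))]]].
  split; first by exists (fun=> 0); split=> //; exists 1.
    move=> P Q [x [xs [d d0 dP]]] [y [ys [d' d'0 dQ]]].
    exists (interleave x y); split; first exact: square_summable_interleave.
    exists (Num.min d d'); first by rewrite lt_min d0.
    move=> a [Ma aa a0 ad].
    have g0 t : 0 <= rip t (a t) by have := a0 t; rewrite lecE => /andP[].
    have h := le_sum_interleave g0 ad.
    have s0 (z : nat -> H) N : 0 <= \sum_(0 <= n < N) rip (z n) (a (z n)).
      by apply: sumr_ge0 => n _.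
    split; [apply: dP|apply: dQ]; split=> // N.
      by apply: le_trans (le_trans (h N) _); rewrite ?ge_min ?lexx ?orbT ?lerDl.
    by apply: le_trans (le_trans (h N) _); rewrite ?ge_min ?lexx ?orbT ?lerDr.
  move=> P Q PQ [x [xs [d d0 dP]]]; exists x; split=> //; exists d => //.
  exact: subset_trans PQ.
have FM : F M by exists (fun=> 0); split=> //; exists 1 => // a [].
have F0 : sigma_weak_cvg F 0.
  move=> x y xs ys.
  have -> : sigma_weak_functional x y 0 = 0.
    rewrite /sigma_weak_functional; apply: cvg_lim; first exact: norm_hausdorff.
    rewrite (_ : series _ = cst 0); first exact: cvg_cst.
    by apply/funext => N; rewrite /series /= big1// => n _; rewrite ip0r.
  apply/cvgrPdist_lt => r' /gt0_complexP[r r0 ->].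
  exists (interleave x y); split; first exact: square_summable_interleave.
  exists (r / 2); first by rewrite divr_gt0.
  move=> a [Ma aa a0 ar] /=; rewrite sub0r normrN normcE_normr ltcR.
  have g0 t : 0 <= rip t (a t) by have := a0 t; rewrite lecE => /andP[].
  have h := le_sum_interleave g0 ar.
  have [||l lP lr] := @complex_series_cvg R (fun n => ip (x n) (a (y n)))
    (fun n => rip (x n) (a (x n)) + rip (y n) (a (y n))) (r / 2).
  - by move=> n; apply: positive_op_ip_le => //; exact: vn_linear Ma.
  - by move=> N; rewrite big_split; exact: h.
  rewrite /sigma_weak_functional (cvg_lim _ lP); last exact: norm_hausdorff.
  by apply: le_lt_trans lr _; rewrite ltr_pdivrMr// ltr_pMr// ltr1n.
(* For the sequence k, 0, 0, ... the sigma-weak functional is a |-> <k, a k>. *)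
pose x0 n : H := if n is 0%N then k else 0.
have x0s : square_summable x0.
  apply/square_summableP; exists (rnorm k ^+ 2) => -[|N].
    by rewrite big_geq// sqr_ge0.
  rewrite big_nat_recl//= big1 ?addr0// => n _.
  by rewrite rnorm0 expr0n.
have swf (a : H -> H) : sigma_weak_functional x0 x0 a = ip k (a k).
  rewrite /sigma_weak_functional; apply: cvg_lim; first exact: norm_hausdorff.
  apply: cvg_near_cst; exists 1%N => // -[//|N] _.
  rewrite /series /= big_nat_recl//= big1 ?addr0// => n _.
  by rewrite ip0l.
have := nf F 0 FF FM (vn0 M) F0 x0 x0 x0s x0s.
move=> /cvgrPdist_lt /(_ e%:C); rewrite ltcR => /(_ e0)[x [xs [d d0 dP]]].
exists x; split=> //; exists d => // a Ma aa a0 ad.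
have := dP a; rewrite /= !swf f0 ip0r sub0r normrN normcE_normr ltcR.
by apply; split.
Qed.

End NormalMaps.

(** * Balanced tensor products *)

Section BalancedTensor.
Context {R : realType} {H : hilbertType R} {M : vonNeumannAlgebra H}.

(** The difference u of the two sides pairs to zero with elementary tensors and is itself a
    combination of them, so <u, u> = 0. *)
Lemma bt_balanced (E F : wCorrespondence M) (EF : balancedTensor E F) x a y :
  M a -> bt EF (ract x a) y = bt EF x (lact a y).
Proof.
move=> Ma; have key g z : mip (bt EF g z) (bt EF (ract x a) y) =
    mip (bt EF g z) (bt EF x (lact a y)).
  by rewrite !bt_mip mip_ract// lactM//; exact: mip_in.
apply/eqP; rewrite -subr_eq0; apply/eqP; apply: mip_eq0.
set u := _ - _; have uP g z : mip (bt EF g z) u = 0.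
  by rewrite /u (linB (mip_linear _)) key subrr.
apply/funext => k; apply: ip_extr => h.
rewrite {2}/u (linB (mip_linear u)) !fctE ipBr.
by rewrite ![ip h (mip u _ k)]ip_mipC !uP !ip0r rmorph0 subrr.
Qed.

Lemma lact0 (E : wCorrespondence M) (y : E) : lact 0 y = 0.
Proof.
have := lact_linearl (0 : E) (-1) (vn_id M) (vn_id M).
have := lact_linearl y (-1) (vn_id M) (vn_id M).
rewrite scaleN1r addNr => -> _.
by rewrite scaleN1r addNr.
Qed.

Context (Psi1 Psi2 : (H -> H) -> (H -> H)).
Context (h1 : cp_map M Psi1) (h2 : cp_map M Psi2).
Context (A : GNS M Psi1) (B : GNS M Psi2) (AB : balancedTensor A B).

Definition bt_gns (a b : H -> H) : AB := bt AB (gns_t A a b) (gns_vector B).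

(** The kernel of [t3_ip], by which [tensor3] is identified with the interior tensor product of
    [AB]. *)
Lemma bt_gns_mip a b a' b' : M a -> M b -> M a' -> M b' ->
  mip (bt_gns a b) (bt_gns a' b') = Psi2 (adj b \o Psi1 (adj a \o a') \o b').
Proof.
move=> Ma Mb Ma' Mb'; rewrite bt_mip gns_mip//.
have Mm : M (adj b \o Psi1 (adj a \o a') \o b').
  apply: vn_comp => //; apply: vn_comp; first by case: (vn_adjoint Mb).
  by apply: (cp_stable h1); apply: vn_comp => //; case: (vn_adjoint Ma).
by rewrite /gns_vector gns_lact ?gns_mip ?adj_id//; exact: vn_id.
Qed.

Lemma bt_gns_lact c a b : M c -> M a -> M b -> lact c (bt_gns a b) = bt_gns (c \o a) b.
Proof. by move=> Mc Ma Mb; rewrite bt_lact// gns_lact. Qed.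

(** Since c (x) d is c xi d, balancing moves c into the left leg and d acts on the right. *)
Lemma bt_gns_t a b c d : M a -> M b -> M c -> M d ->
  bt AB (gns_t A a b) (gns_t B c d) = ract (bt_gns a (b \o c)) d.
Proof.
move=> Ma Mb Mc Md; rewrite bt_ract// -gns_ract// bt_balanced//.
rewrite (lact_ract _ Mc Md) /gns_vector gns_lact ?gns_ract//; exact: vn_id.
Qed.

(* Orthogonality of g to the elementary tensors extends in the right leg by
   self-duality of B, and in the left leg by sigma-strong density of the elementary
   tensors in A together with normality of the left action on B. *)
Theorem bt_gns_separating (g : AB) :
  (forall a b, M a -> M b -> mip g (bt_gns a b) = 0) -> g = 0.
Proof.
move=> g0; have [T _] := interior_tensor_exists AB.
have [TA _] := interior_tensor_exists A; have [TB _] := interior_tensor_exists B.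
have norm_bt x y k : rnorm (it T (bt AB x y) k) ^+ 2 =
    rip k (mip y (lact (mip x x) y) k) by rewrite it_rnorm_sqr bt_mip.
have step2 a b y : M a -> M b -> mip g (bt AB (gns_t A a b) y) = 0.
  move=> Ma Mb; set x := gns_t A a b.
  have [L [bL LP]] := gns_left_ampliation h2 TB (mip_in x x).
  have [r r0 rL] := bounded_linear_ge0 bL.
  have [c cP] : exists c : B, forall y, mip g (bt AB x y) = mip c y.
    apply: (wc_self_dual (w := B)); split.
    - by move=> z _; exact: mip_in.
    - by move=> c z z' _ _; rewrite bt_linear2 mip_linear.
    - by move=> z c _ Mc; rewrite -bt_ract// mip_ract.
    exists (hmnorm g * Num.sqrt r) => z _; apply: opnorm_le.
      by rewrite !mulr_ge0 ?sqrtr_ge0.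
    move=> k; apply: rnorm_le_ip; first by rewrite !mulr_ge0 ?sqrtr_ge0 ?rnorm_ge0.
    move=> h; rewrite -(it_ip T); apply: le_trans (normc_ip_le _ _) _.
    (* The squared norm of x (x) z (x) k is that of <z (x) k, L (z (x) k)>, where L is left
       multiplication by <x, x> with bound r. *)
    have h3 : rnorm (it T (bt AB x z) k) <= Num.sqrt r * (hmnorm z * rnorm k).
      apply: le_trans (_ : Num.sqrt r * rnorm (it TB z k) <= _); last first.
        by rewrite ler_wpM2l ?sqrtr_ge0// it_rnorm_le.
      rewrite -(@ler_pXn2r _ 2) ?nnegrE ?mulr_ge0 ?sqrtr_ge0 ?rnorm_ge0//.
      rewrite norm_bt /rip -(it_ip TB) -LP exprMn sqr_sqrtr//.
      apply: le_trans (rip_le _ _) _; rewrite mulrC expr2 mulrA.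
      by rewrite ler_wpM2r ?rnorm_ge0.
    apply: le_trans (ler_pM (rnorm_ge0 _) (rnorm_ge0 _) (it_rnorm_le T g h) h3) _.
    by rewrite le_eqVlt; apply/orP; left; apply/eqP; ring.
  rewrite cP (_ : c = 0).
    apply/funext => k; apply: ip_extr => h.
    by rewrite ip_mipC (lin0 (mip_linear y)) ip0r rmorph0 ip0r.
  apply: (@gns_separating _ _ _ _ B) => c' d Mc Md.
  rewrite -cP bt_gns_t// mip_ract// g0//; exact: vn_comp.
pose S := [set x : A | forall y, mip g (bt AB x y) = 0].
have Sgns a b : M a -> M b -> S (gns_t A a b) by move=> Ma Mb y; exact: step2.
have step3 x y : mip g (bt AB x y) = 0.
  apply/funext => k; apply: ip_extr => h; rewrite ip0r.
  apply/eq0_normc/eqP; rewrite eq_le normc_ge0 andbT.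
  apply: (@le_of_forall_inv _ _ _ (rnorm (it T g h))) => j.
  have hj := harmonic_gt0 j : 0 < harmonic j :> R.
  have f0 : mip y (lact 0 y) = 0 by rewrite lact0 (lin0 (mip_linear y)).
  (* Normality of a |-> <y, a y> yields the vectors on which x - s must be small; it is applied to a
     = <x - s, x - s>, and the tolerance is squared because a norm is. *)
  have [u [/square_summableP[C uC] [d d0 dP]]] :=
    normal_small (@lact_normal _ _ _ _ y y) f0 k (exprn_gt0 2 hj).
  have [s Ss sP] : exists2 s, S s & forall N,
      \sum_(0 <= n < N) rnorm (it TA (x - s) (u n)) ^+ 2 <= d.
    apply: (@strong_density _ _ _ _ TA S _ _ _ _ x u C) => //.
    - move=> c v w Sv Sw z; rewrite bt_linear1 (mip_linear g).
      by rewrite Sv Sw scaler0 addr0.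
    - by move=> v a Sv Ma z; rewrite bt_balanced.
    - by exists (gns_t A id id); apply: Sgns; exact: vn_id.
    - move=> v vS; apply: (@gns_total _ _ _ _ _ TA) => -[[[a Ma] [b Mb]] l].
      by apply: vS; exact: Sgns.
  have -> : mip g (bt AB x y) = mip g (bt AB (x - s) y).
    by rewrite (linB (bt_linear1 AB y)) (linB (mip_linear g)) Ss subr0.
  rewrite -(it_ip T) add0r; apply: le_trans (normc_ip_le _ _) _.
  rewrite ler_wpM2l ?rnorm_ge0//.
  rewrite -(@ler_pXn2r _ 2) ?nnegrE ?rnorm_ge0 ?(ltW hj)// norm_bt.
  apply: le_trans (ler_norm _) _; apply: le_trans (le_Re_normc _) _; apply: ltW.
  apply: dP; [exact: mip_in|exact: mip_adj|exact: mip_ge0|].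
  by move=> N; apply: le_trans (sP N); under [leRHS]eq_bigr do rewrite it_rnorm_sqr.
apply: (self_dual_extension_separating (bt_extension AB)) => _ [n [x [y ->]]].
by rewrite (lin_sum (mip_linear g)) big1.
Qed.

Lemma bt_gns_total (T : interior_tensor AB) :
  total (fun p : ({a | M a} * {b | M b}) * H => it T (bt_gns (sval p.1.1) (sval p.1.2)) p.2).
Proof.
apply: (@separating_total _ _ _ _ AB T
  (fun i : {a | M a} * {b | M b} => bt_gns (sval i.1) (sval i.2))).
  exact: wc_self_dual.
move=> g gE; apply: bt_gns_separating => a b Ma Mb.
exact: (gE (exist _ a Ma, exist _ b Mb)).
Qed.

Lemma bt_gns_left_ampliation (T : interior_tensor AB) c : M c ->
  exists L : T -> T, bounded_linear L /\
    forall x h, L (it T x h) = it T (lact c x) h.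
Proof.
move=> Mc; apply: (@left_ampliation _ _ _ _ AB T
  (fun i : {a | M a} * {b | M b} => bt_gns (sval i.1) (sval i.2)) c) => //.
- exact: bt_gns_total.
- move=> {Mc}c [[a Ma] [b Mb]] Mc.
  by exists (exist _ (c \o a) (vn_comp Mc Ma), exist _ b Mb); rewrite /= bt_gns_lact.
move=> [[a Ma] [b Mb]] [[a' Ma'] [b' Mb']] /=.
have [Ma1 _] := vn_adjoint Ma; have [Mb1 _] := vn_adjoint Mb.
have [C C0 CP] := cp_sandwich_bound h1 Ma1 Ma'.
have [D D0 DP] := cp_sandwich_bound h2 Mb1 Mb'.
exists (D * C) => s Ms h k.
have Ms1 : M (Psi1 (adj a \o (s \o a'))).
  exact: (cp_stable h1) (vn_comp Ma1 (vn_comp Ms Ma')).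
have Ms2 : M (Psi2 (adj b \o (Psi1 (adj a \o (s \o a')) \o b'))).
  exact: (cp_stable h2) (vn_comp Mb1 (vn_comp Ms1 Mb')).
rewrite bt_gns_lact// bt_gns_mip//; last exact: vn_comp.
apply: le_trans (normc_ip_le _ _) _.
apply: le_trans (_ : rnorm h * (D * (C * opnorm s) * rnorm k) <= _).
  rewrite ler_wpM2l ?rnorm_ge0//.
  apply: le_trans (rnorm_opnorm _ (vn_bounded Ms2)) _; rewrite ler_wpM2r ?rnorm_ge0//.
  by apply: le_trans (DP _ Ms1) _; rewrite ler_wpM2l// CP.
by rewrite le_eqVlt; apply/orP; left; apply/eqP; ring.
Qed.

Lemma tensor3_total (K : tensor3 M Psi1 Psi2) :
  total (fun p : ({a | M a} * {b | M b}) * H => t3 K (sval p.1.1) (sval p.1.2) p.2).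
Proof.
move=> x xK; apply: rnorm_eq0; apply/eqP; apply: contraT => xn0.
have x0 : 0 < rnorm x by rewrite lt_neqAle eq_sym xn0 rnorm_ge0.
(* An approximant y would satisfy |x - y| < |x|, although orthogonality gives |x - y|^2 = |x|^2 +
   |y|^2. *)
have [] := @t3_dense _ _ _ _ _ K (ball x (rnorm x)%:C).
- by exists x; apply: ballxx; rewrite ltcR.
- exact: ball_open.
move=> y [+ [n [a [b [h [ab ye]]]]]]; rewrite -ball_normE /ball_/= rnormE ltcR.
have xy : rip x y = 0.
  rewrite /rip ye ip_sumr big1// => i _; have [Ma Mb] := ab i.
  exact: (xK ((exist _ _ Ma, exist _ _ Mb), h i)).
rewrite -(@ltr_pXn2r _ 2) ?nnegrE ?rnorm_ge0// rnormB_sqr xy mulr0 subr0.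
by rewrite ltNge lerDl sqr_ge0.
Qed.

(** Two total families with the same Gram kernel; totality on the side of [T] rests on
    [bt_gns_separating]. *)
Theorem tensor3_interior (K : tensor3 M Psi1 Psi2) (T : interior_tensor AB) :
  exists (U : K -> T) (V : T -> K), [/\ unitary U, unitary V,
    forall a b h, M a -> M b -> U (t3 K a b h) = it T (bt_gns a b) h,
    forall a b h, M a -> M b -> V (it T (bt_gns a b) h) = t3 K a b h &
    (forall x, V (U x) = x) /\ (forall y, U (V y) = y)].
Proof.
have [|U [V [uU uV UP VP UV]]] :=
    @unitary_extension _ _ _ _ _ _ (@tensor3_total K) (@bt_gns_total T).
  move=> [[[a Ma] [b Mb]] h] [[[a' Ma'] [b' Mb']] k] /=.
  by rewrite t3_ip// it_ip bt_gns_mip.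
exists U, V; split=> // a b h Ma Mb.
  exact: (UP ((exist _ a Ma, exist _ b Mb), h)).
exact: (VP ((exist _ a Ma, exist _ b Mb), h)).
Qed.

End BalancedTensor.

(** * Strong commutation *)

Section Unitaries.
Context {R : realType}.

Lemma unitary_comp (U V W : hilbertType R) (f : V -> W) (g : U -> V) :
  unitary f -> unitary g -> unitary (f \o g).
Proof.
move=> [lf ipf sf] [lg ipg sg]; split.
- by move=> c x y /=; rewrite lg lf.
- by move=> x y /=; rewrite ipf ipg.
- by move=> z; have [y <-] := sf z; have [x <-] := sg y; exists x.
Qed.

Lemma unitary_inverse (V W : hilbertType R) (u : V -> W) : unitary u ->
  exists v : W -> V, [/\ unitary v, cancel u v & cancel v u].
Proof.
move=> uu; have [lu ipu su] := uu; have [v vP] := choice su.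
have uI x y : u x = u y -> x = y.
  move=> xy; apply: ip_ext => z; by rewrite -ipu xy ipu.
exists v; split=> //; last by move=> x; exact: uI.
split.
- by move=> c x y; apply: uI; rewrite vP lu !vP.
- by move=> x y; rewrite -ipu !vP.
- by move=> x; exists (u x); exact: uI.
Qed.

End Unitaries.

(** * Ampliations under the identification with the interior tensor product *)

Section Ampliations.
Context {R : realType} {H : hilbertType R} {M : vonNeumannAlgebra H}.

Lemma commutant_ampliation_exists (X : preHilbertModule M) (T : interior_tensor X) d :
  commutant M d -> exists D : T -> T, bounded_linear D /\
    forall x h, D (it T x h) = it T x (d h).
Proof.
move=> Md; have [d' Md' dd'] := commutant_adjoint Md.
by have [D [bD DT _]] := commutant_ampliation T Md Md' dd'; exists D.
Qed.

Lemma intertwiner_commute (X Y : preHilbertModule M) (S : interior_tensor X)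
    (T : interior_tensor Y) (A : S -> T) : bounded_linear A ->
  (forall d, commutant M d -> forall (D : S -> S) (D' : T -> T),
    bounded_linear D -> bounded_linear D' ->
    (forall x h, D (it S x h) = it S x (d h)) ->
    (forall x h, D' (it T x h) = it T x (d h)) -> forall v, A (D v) = D' (A v)) ->
  intertwiner A.
Proof.
move=> bA AD; split=> // d d' Md Md' dd' z h y k.
have [D [bD DP _]] := commutant_ampliation S Md Md' dd'.
have [D' [bD' D'P D'a]] := commutant_ampliation T Md Md' dd'.
by rewrite -DP (AD d Md D D')// ip_conj D'a -ip_conj.
Qed.

Context (Psi1 Psi2 : (H -> H) -> (H -> H)).
Context (h1 : cp_map M Psi1) (h2 : cp_map M Psi2).
Context (A : GNS M Psi1) (B : GNS M Psi2) (AB : balancedTensor A B).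
Context (K : tensor3 M Psi1 Psi2) (T : interior_tensor AB).
Context (U : K -> T) (V : T -> K).
Context (uU : unitary U) (uV : unitary V) (UK : cancel U V) (VK : cancel V U).
Context (UP : forall a b h, M a -> M b ->
  U (t3 K a b h) = it T (bt_gns AB a b) h).

Let VP a b h : M a -> M b -> V (it T (bt_gns AB a b) h) = t3 K a b h.
Proof. by move=> Ma Mb; rewrite -UP// UK. Qed.

Let bU : bounded_linear U := unitary_bounded uU.
Let bV : bounded_linear V := unitary_bounded uV.

(** Supplies the ampliations on K whose existence [commute_strongly] asserts, by conjugating those
    of T. *)
Lemma left_ampliation_transfer c : M c -> exists L : K -> K, is_left_ampliation c L /\
  forall x h, L (V (it T x h)) = V (it T (lact c x) h).
Proof.
move=> Mc; have [C [bC CP]] := bt_gns_left_ampliation h1 h2 T Mc.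
exists (V \o (C \o U)); split; last by move=> x h /=; rewrite VK CP.
split; first by do 2![apply: bounded_linear_comp => //].
move=> a b h Ma Mb /=; rewrite UP// CP bt_gns_lact// VP//; exact: vn_comp.
Qed.

Lemma right_ampliation_transfer d : commutant M d ->
  exists L : K -> K, is_right_ampliation d L /\
  forall x h, L (V (it T x h)) = V (it T x (d h)).
Proof.
move=> Md; have [D [bD DP]] := commutant_ampliation_exists T Md.
exists (V \o (D \o U)); split; last by move=> x h /=; rewrite VK DP.
split; first by do 2![apply: bounded_linear_comp => //].
by move=> a b h Ma Mb /=; rewrite UP// DP VP.
Qed.

(** The uniqueness counterpart: an arbitrary ampliation given by [commute_strongly] agrees with the
    one on T, both being determined on elementary tensors. *)
Lemma left_ampliation_conj c (L : K -> K) (C : T -> T) : M c ->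
  is_left_ampliation c L -> bounded_linear C ->
  (forall x h, C (it T x h) = it T (lact c x) h) -> forall v, U (L v) = C (U v).
Proof.
move=> Mc [bL LP] bC CP.
apply: (@eq_on_total _ _ _ _ _ (U \o L) (C \o U)
  (@tensor3_total _ _ _ _ _ K)).
- exact: bounded_linear_comp.
- exact: bounded_linear_comp.
move=> [[[a Ma] [b Mb]] h] /=; rewrite LP// !UP ?CP ?bt_gns_lact//.
exact: vn_comp.
Qed.

Lemma right_ampliation_conj d (L : K -> K) (D : T -> T) :
  is_right_ampliation d L -> bounded_linear D ->
  (forall x h, D (it T x h) = it T x (d h)) -> forall v, U (L v) = D (U v).
Proof.
move=> [bL LP] bD DP.
apply: (@eq_on_total _ _ _ _ _ (U \o L) (D \o U)
  (@tensor3_total _ _ _ _ _ K)).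
- exact: bounded_linear_comp.
- exact: bounded_linear_comp.
by move=> [[[a Ma] [b Mb]] h] /=; rewrite LP// !UP ?DP.
Qed.

End Ampliations.

Section StrongCommutation.
Context {R : realType} {H : hilbertType R} {M : vonNeumannAlgebra H}.
Context (Theta Phi : (H -> H) -> (H -> H)).
Context (hTheta : cp_map M Theta) (hPhi : cp_map M Phi).
Context (K1 : tensor3 M Phi Theta) (K2 : tensor3 M Theta Phi).
Context (E : GNS M Theta) (F : GNS M Phi).
Context (EF : balancedTensor E F) (FE : balancedTensor F E).

Lemma bimodule_unitary_commute (w : EF -> FE) : unitary_bimodule_map w ->
  w (bt EF (gns_vector E) (gns_vector F)) = bt FE (gns_vector F) (gns_vector E) ->
  commute_strongly K1 K2.
Proof.
move=> [lw wract wlact wmip wsurj] wxi.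
have [T1 _] := interior_tensor_exists FE; have [T2 _] := interior_tensor_exists EF.
have [U1 [V1 [uU1 uV1 U1P V1P [U1K V1K]]]] := tensor3_interior hPhi hTheta K1 T1.
have [U2 [V2 [uU2 uV2 U2P V2P [U2K V2K]]]] := tensor3_interior hTheta hPhi K2 T2.
have tw : total (fun p : EF * H => it T1 (w p.1) p.2).
  move=> v vw; apply: (@it_total _ _ _ _ T1) => -[y h] /=.
  by have [x <-] := wsurj y; exact: (vw (x, h)).
have [|W [W' [uW uW' WP W'P [WK W'K]]]] :=
    unitary_extension (@it_total _ _ _ _ T2) tw.
  by move=> [x h] [y k] /=; rewrite !it_ip wmip.
pose u : K1 -> K2 := V2 \o (W' \o U1).
(* Surjectivity of w provides such an x for all a, b, so this determines u on every elementary
   tensor. *)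
have u_w a b h x : M a -> M b -> w x = bt_gns FE a b ->
    u (t3 K1 a b h) = V2 (it T2 x h).
  by move=> Ma Mb wx; rewrite /u /= U1P// -wx (W'P (x, h)).
exists u; split.
- by do 2![apply: unitary_comp => //].
(* The vector for (a, I) is a applied to that for (I, I), so left linearity and the value of w at xi
   (x) eta suffice. *)
- move=> a h Ma; rewrite (u_w a id h (bt_gns EF a id)) ?V2P//; try exact: vn_id.
  have MI := vn_id M.
  by rewrite -(bt_gns_lact EF Ma MI MI) wlact// wxi -[RHS](bt_gns_lact FE Ma MI MI).
- move=> c Mc; have [L [Lc LP]] := left_ampliation_transfer hTheta hPhi uU2 uV2 U2K V2K U2P Mc.
  exists L => // a b h Ma Mb; have [x wx] := wsurj (bt_gns FE a b).
  rewrite (u_w a b h x)// LP (u_w (c \o a) b h (lact c x))//; first exact: vn_comp.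
  by rewrite wlact// wx bt_gns_lact.
- move=> d Md; have [L [Lc LP]] := right_ampliation_transfer uU2 uV2 U2K V2K U2P Md.
  exists L => // a b h Ma Mb; have [x wx] := wsurj (bt_gns FE a b).
  by rewrite !(u_w a b _ x)// LP.
Qed.

Lemma commute_bimodule_unitary : commute_strongly K1 K2 ->
  exists w : EF -> FE, unitary_bimodule_map w /\
    w (bt EF (gns_vector E) (gns_vector F)) = bt FE (gns_vector F) (gns_vector E).
Proof.
move=> [u [uu uxi uleft uright]].
have [T1 _] := interior_tensor_exists FE; have [T2 _] := interior_tensor_exists EF.
have [U1 [V1 [uU1 uV1 U1P V1P [U1K V1K]]]] := tensor3_interior hPhi hTheta K1 T1.
have [U2 [V2 [uU2 uV2 U2P V2P [U2K V2K]]]] := tensor3_interior hTheta hPhi K2 T2.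
pose V : T1 -> T2 := U2 \o (u \o V1).
have uV : unitary V by do 2![apply: unitary_comp => //].
have [V' [uV' VK V'K]] := unitary_inverse uV.
have bV := unitary_bounded uV; have bV' := unitary_bounded uV'.
have VE a b h : M a -> M b -> V (it T1 (bt_gns FE a b) h) = U2 (u (t3 K1 a b h)).
  by move=> Ma Mb; rewrite /V /= V1P.
have VD d (Md : commutant M d) (D1 : T1 -> T1) (D2 : T2 -> T2) :
    bounded_linear D1 -> bounded_linear D2 ->
    (forall x h, D1 (it T1 x h) = it T1 x (d h)) ->
    (forall x h, D2 (it T2 x h) = it T2 x (d h)) -> forall v, V (D1 v) = D2 (V v).
  move=> bD1 bD2 D1P D2P; have [L Ld LP] := uright d Md.
  apply: (@eq_on_total _ _ _ _ _ (V \o D1) (D2 \o V)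
    (@bt_gns_total _ _ _ _ _ hTheta _ _ _ T1)).
  - exact: bounded_linear_comp.
  - exact: bounded_linear_comp.
  move=> [[[a Ma] [b Mb]] h] /=; rewrite D1P !VE// LP//.
  exact: (right_ampliation_conj uU2 U2P Ld bD2 D2P).
have VC c (Mc : M c) (C1 : T1 -> T1) (C2 : T2 -> T2) :
    bounded_linear C1 -> bounded_linear C2 ->
    (forall x h, C1 (it T1 x h) = it T1 (lact c x) h) ->
    (forall x h, C2 (it T2 x h) = it T2 (lact c x) h) -> forall v, V (C1 v) = C2 (V v).
  move=> bC1 bC2 C1P C2P; have [L Lc LP] := uleft c Mc.
  apply: (@eq_on_total _ _ _ _ _ (V \o C1) (C2 \o V)
    (@bt_gns_total _ _ _ _ _ hTheta _ _ _ T1)).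
  - exact: bounded_linear_comp.
  - exact: bounded_linear_comp.
  move=> [[[a Ma] [b Mb]] h] /=; rewrite C1P bt_gns_lact// !VE//; last exact: vn_comp.
  rewrite LP//; exact: (left_ampliation_conj uU2 U2P Mc Lc bC2 C2P).
have iV : intertwiner V by apply: intertwiner_commute.
have iV' : intertwiner V'.
  apply: intertwiner_commute => // d Md D2 D1 bD2 bD1 D2P D1P v.
  by rewrite -{1}(V'K v) -(VD d Md D1 D2)// VK.
have [lV' ipV' _] := uV'; have [_ ipV _] := uV.
(* Here c represents y |-> z^* V y; as V' is the adjoint of V, it maps z (x) h to c (x) h for all
   h. *)
have /choice[w wP] : forall z : EF, exists c : FE, forall h, V' (it T2 z h) = it T1 c h.
  move=> z; have [c cP] := intertwiner_self_dual z (wc_self_dual (w := FE)) iV.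
  exists c => h; apply: it_ext => y k.
  by rewrite -cP -ipV V'K.
exists w; split; first split.
- move=> c x y; apply: (it_inj (T := T1)) => h.
  by rewrite -wP (it_linearl T2) lV' !wP (it_linearl T1).
- move=> x a Ma; apply: (it_inj (T := T1)) => h.
  by rewrite -wP !it_ract// wP.
- move=> c x Mc; apply: (it_inj (T := T1)) => h.
  have [C1 [bC1 C1P]] := bt_gns_left_ampliation hPhi hTheta T1 Mc.
  have [C2 [bC2 C2P]] := bt_gns_left_ampliation hTheta hPhi T2 Mc.
  rewrite -wP -C1P -C2P -wP -{1}(V'K (it T2 x h)) -(VC c Mc C1 C2)// VK.
- move=> x y; apply/funext => k; apply: ip_extr => h.
  by rewrite -(it_ip T1) -(it_ip T2) -!wP ipV'.
(* The same construction with V and V' exchanged yields the preimage of z. *)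
- move=> z; have [c cP] := intertwiner_self_dual z (wc_self_dual (w := EF)) iV'.
  exists c; apply: (it_inj (T := T1)) => h; rewrite -wP -[RHS]VK.
  congr V'; apply: it_ext => y k.
  by rewrite -cP -[RHS]ipV' VK.
apply: (it_inj (T := T1)) => h; have MI := vn_id M.
rewrite -wP -[RHS]VK; congr V'.
rewrite -[bt FE _ _]/(bt_gns FE id id) VE// uxi// U2P//.
Qed.

End StrongCommutation.

Theorem proposition2p14 (R : realType) (H : hilbertType R)
    (M : vonNeumannAlgebra H) (Theta Phi : (H -> H) -> (H -> H))
    (hTheta : cp_map M Theta) (hPhi : cp_map M Phi)
    (K1 : tensor3 M Phi Theta) (K2 : tensor3 M Theta Phi)
    (E : GNS M Theta) (F : GNS M Phi)
    (EF : balancedTensor E F) (FE : balancedTensor F E) :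
  commute_strongly K1 K2 <->
  exists w : EF -> FE, unitary_bimodule_map w /\
    w (bt EF (gns_vector E) (gns_vector F)) = bt FE (gns_vector F) (gns_vector E).
Proof.
split; first exact: commute_bimodule_unitary.
by move=> [w [uw wxi]]; exact: bimodule_unitary_commute wxi.
Qed.
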